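(* Let $(V,\phi)$ be a unitary simple vertex operator algebra of CFT type with central charge $c=1$, and let $\mathfrak{h}=\mathbb{C}\alpha$ be a one-dimensional abelian subalgebra of the Lie algebra $V_1$ such that $\phi(\alpha)\in\mathbb{R}\alpha$. Then $V$ is isomorphic to the Heisenberg vertex operator algebra $M_{\mathfrak{h}}(1,0)$ or to the lattice vertex operator algebra $V_L$ for some positive definite even lattice $L$ of rank $1$.
   Context: CFT type means $V=\bigoplus_{n\ge0}V_n$ and $V_0=\mathbb{C}\mathbf{1}$; then $V_1$ is a Lie algebra under $[a,b]=a_0b$, where $Y(a,z)=\sum_na_nz^{-n-1}$. $M_{\mathfrak{h}}(1,0)$ is the (rank one) Heisenberg vertex operator algebra of level one attached to the one-dimensional space $\mathfrak{h}$ with a non-degenerate symmetric bilinear form, with its standard Virasoro vector $\frac12\beta(-1)^2\mathbf{1}$ for $\beta\in\mathfrak{h}$ with $(\beta,\beta)=1$; $V_L$ is the standard lattice vertex operator algebra $M_{\mathbb{C}\otimes L}(1,0)\otimes\mathbb{C}[L]$. With $Y(\omega,z)=\sum_nL(n)z^{-n-2}$, an anti-linear automorphism of $V$ is an anti-linear bijection $\phi:V\to V$ with $\phi(\mathbf{1})=\mathbf{1}$, $\phi(\omega)=\omega$, $\phi(u_nv)=\phi(u)_n\phi(v)$; an anti-linear involution is one of order $2$. For an anti-linear involution $\phi$, $(V,\phi)$ is unitary if there is a positive definite Hermitian form $(\cdot,\cdot)$ on $V$, linear in the first and anti-linear in the second variable, such that $(Y(e^{zL(1)}(-z^{-2})^{L(0)}a,z^{-1})u,v)=(u,Y(\phi(a),z)v)$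 for all $a,u,v\in V$ (the formal variable $z$ being treated as real). *)

(* Defs.v *)
From HB Require Import structures.
From mathcomp Require Import all_boot all_order all_algebra.
From mathcomp Require Import finmap multiset monalg complex.
From mathcomp Require Import boolp classical_sets fsbigop reals.

Set Implicit Arguments.
Unset Strict Implicit.
Unset Printing Implicit Defensive.
Import Order.TTheory GRing.Theory Num.Theory.
Local Open Scope ring_scope.

(* In this file [\sum_(i \in A) E i], with [A] a classical set, is the sum of
   the nonzero terms of a family of finite support.  All the infinite sums of
   vertex operator calculus below are of this kind: they are evaluated on
   vectors, where the truncation condition leaves finitely many terms. *)

(* The binomial coefficient z (z - 1) ... (z - j + 1) / j!, for any integer z. *)
Definition binz (F : fieldType) (z : int) (j : nat) : F :=
  (\prod_(i < j) (z - i%:Z)%:~R) / (j`!)%:R.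

(** * Vertex operator algebras *)

(* [mode u n v] is u_n v, where Y(u, z) = \sum_n u_n z^(- n - 1). *)
Record vertexData (F : fieldType) := VertexData {
  vspace_of :> lmodType F;
  mode : vspace_of -> int -> vspace_of -> vspace_of;
  vac : vspace_of;
  conf : vspace_of }.
Arguments mode {F V} u n v : rename.
Arguments vac {F V} : rename.
Arguments conf {F V} : rename.

(* L(n) is the coefficient of z^(- n - 2) in Y(omega, z). *)
Definition vir (F : fieldType) (V : vertexData F) (n : int) (v : V) : V :=
  mode conf (n + 1) v.

Definition homogeneous (F : fieldType) (V : vertexData F) (n : int) (v : V) :=
  vir 0 v = n%:~R *: v.

(* [va_borcherds] is the component form of the Jacobi identity. *)
Record is_VOA (F : fieldType) (V : vertexData F) (c : F) : Prop := IsVOA {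
  va_linl : forall (n : int) (v : V), linear (fun u : V => mode u n v);
  va_linr : forall (n : int) (u : V), linear (mode u n);
  va_trunc : forall u v : V, exists N : int, forall n, N <= n -> mode u n v = 0;
  va_vacuum : forall (n : int) (v : V),
    mode vac n v = if n == -1 then v else 0;
  va_creation : forall u : V,
    mode u (-1) vac = u /\ forall n : int, 0 <= n -> mode u n vac = 0;
  va_borcherds : forall (u v w : V) (l m n : int),
    \sum_(i \in [set: nat])
       binz F m i *: mode (mode u (l + i%:Z) v) (m + n - i%:Z) w =
    \sum_(i \in [set: nat])
       ((-1) ^+ i * binz F l i) *:
         (mode u (l + m - i%:Z) (mode v (n + i%:Z) w) -
          (-1) ^ l *: mode v (l + n - i%:Z) (mode u (m + i%:Z) w));
  voa_virasoro : forall (m n : int) (v : V),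
    vir m (vir n v) - vir n (vir m v) =
    (m - n)%:~R *: vir (m + n) v +
    (if m + n == 0 then ((m ^+ 3 - m)%:~R / 12%:R * c) *: v else 0);
  voa_derivative : forall (u v : V) (n : int),
    mode (vir (-1) u) n v = - n%:~R *: mode u (n - 1) v;
  voa_graded : forall v : V, exists s : seq V,
    (forall x, x \in s -> exists n, homogeneous n x) /\ v = \sum_(x <- s) x;
  voa_finite_dim : forall n : int, exists s : seq V,
    forall v : V, homogeneous n v ->
      exists a : 'I_(size s) -> F, v = \sum_i a i *: s`_i;
  voa_bounded_below : exists N : int,
    forall (n : int) (v : V), n < N -> homogeneous n v -> v = 0 }.

Definition CFT_type (F : fieldType) (V : vertexData F) : Prop :=
  (forall (n : int) (v : V), n < 0 -> homogeneous n v -> v = 0) /\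
  (forall v : V, homogeneous 0 v <-> exists a : F, v = a *: vac).

Definition subspace (F : fieldType) (V : lmodType F) (S : V -> Prop) : Prop :=
  S 0 /\ forall (a : F) (u v : V), S u -> S v -> S (a *: u + v).

Definition ideal (F : fieldType) (V : vertexData F) (I : V -> Prop) : Prop :=
  subspace I /\
  forall (u v : V) (n : int), I v -> I (mode u n v) /\ I (mode v n u).

Definition simple_VOA (F : fieldType) (V : vertexData F) : Prop :=
  (exists v : V, v != 0) /\
  forall I : V -> Prop, ideal I ->
    (forall v, I v -> v = 0) \/ (forall v, I v).

Definition VOA_iso (F : fieldType) (V W : vertexData F) : Prop :=
  exists f : V -> W,
    [/\ linear f, bijective f, f vac = vac, f conf = conf &
        forall (u v : V) (n : int), f (mode u n v) = mode (f u) n (f v)].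

Definition lie_bracket (F : fieldType) (V : vertexData F) (a b : V) : V :=
  mode a 0 b.

Definition abelian_subalgebra (F : fieldType) (V : vertexData F)
    (h : V -> Prop) : Prop :=
  [/\ subspace h, forall a, h a -> homogeneous 1 a &
      forall a b, h a -> h b -> lie_bracket a b = 0].

Definition line (F : fieldType) (V : lmodType F) (x : V) : V -> Prop :=
  fun v => exists a : F, v = a *: x.

(** * Unitarity *)

Definition antilinear_automorphism (C : numClosedFieldType) (V : vertexData C)
    (phi : V -> V) : Prop :=
  [/\ forall (a : C) (u v : V), phi (a *: u + v) = a^* *: phi u + phi v,
      bijective phi, phi vac = vac, phi conf = conf &
      forall (u v : V) (n : int), phi (mode u n v) = mode (phi u) n (phi v)].

Definition antilinear_involution (C : numClosedFieldType) (V : vertexData C)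
    (phi : V -> V) : Prop :=
  [/\ antilinear_automorphism phi, involutive phi & exists v, phi v <> v].

Definition posdef_hermitian (C : numClosedFieldType) (V : lmodType C)
    (form : V -> V -> C) : Prop :=
  [/\ forall (a : C) (u v w : V),
        form (a *: u + v) w = a * form u w + form v w,
      forall u v : V, form v u = (form u v)^* &
      forall v : V, v != 0 -> 0 < form v v].

(* For a of weight r, (- z^-2)^L(0) a = (-1)^r z^(- 2 r) a, so that
     Y(e^(z L(1)) (- z^-2)^L(0) a, z^-1)
     = \sum_(i, m) (-1)^r / i! (L(1)^i a)_m z^(i - 2 r + m + 1);
   the equation below compares the coefficients of z^(- n - 1).  As
   (- z^-2)^L(0) is defined on V by linearity from homogeneous vectors, and
   both sides are linear in a, only homogeneous a are considered. *)
Definition invariant_form (C : numClosedFieldType) (V : vertexData C)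
    (phi : V -> V) (form : V -> V -> C) : Prop :=
  forall (r : int) (a u v : V) (n : int), homogeneous r a ->
    form (\sum_(i \in [set: nat])
            ((-1) ^ r / (i`!)%:R) *:
              mode (iter i (vir 1) a) (2 * r - i%:Z - n - 2) u) v =
    form u (mode (phi a) n v).

Definition unitary (C : numClosedFieldType) (V : vertexData C)
    (phi : V -> V) : Prop :=
  antilinear_involution phi /\
  exists form : V -> V -> C, posdef_hermitian form /\ invariant_form phi form.

(** * The rank one Heisenberg and lattice vertex operator algebras *)

(* Linear extension of a map defined on the basis [K] of {malg F[K]}. *)
Definition lext (F : fieldType) (K : choiceType) (W : lmodType F) (g : K -> W)
    (x : {malg F[K]}) : W :=
  \sum_(b <- msupp x) x@_b *: g b.

(* For operators g(m), m \in Z, and g(z) = \sum_m g(m) z^(- m - 1), the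
   coefficient of z^(- n - 1) in the normally ordered product
     : (1 / p!) (d/dz)^p g(z) Y(z) :  with  Y(z) = \sum_n Y_n z^(- n - 1),
   where g(m) stands on the left of Y(z) for m < 0, on its right for m >= 0. *)
Definition normal_product (F : fieldType) (W : lmodType F)
    (g : int -> W -> W) (p : nat) (Y : int -> W -> W) (n : int) (w : W) : W :=
  \sum_(m \in [set m : int | m < 0])
     binz F (- m - 1) p *: g m (Y (n - m - p%:Z - 1) w) +
  \sum_(m \in [set m : int | 0 <= m])
     binz F (- m - 1) p *: Y (n - m - p%:Z - 1) (g m w).

(* The space of M_h(1, 0) for h = C gamma, i.e. the symmetric algebra on
   gamma(-1), gamma(-2), ...: the multiset s stands for the monomial
   \prod_(i <- s) gamma(- i - 1). *)
Definition fock (F : fieldType) := {malg F[{mset nat}%mset]}.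

(* The action of gamma(n) on M_h(1, 0), where k = (gamma, gamma):
   multiplication for n < 0, and k n d/d(gamma(-n)) for n >= 0. *)
Definition heis_mode (F : fieldType) (k : F) (n : int) : fock F -> fock F :=
  match n with
  | Negz i => lext (fun s : {mset nat}%mset => << (i +` s)%mset >>)
  | Posz 0 => fun=> 0
  | Posz i.+1 => lext (fun s : {mset nat}%mset =>
      (k * i.+1%:R * (s i)%:R) *: << (s `\ i)%mset >>)
  end.

(* M_h(1, 0) for h = C gamma and the bilinear form with (gamma, gamma) = k,
   k != 0.  For beta = gamma / sqrt k, which has (beta, beta) = 1, one has
   (1 / 2) beta(-1)^2 1 = (1 / 2 k) gamma(-1)^2 1. *)
Definition heisenberg (F : fieldType) (k : F) : vertexData F :=
  @VertexData F (fock F)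
    (fun u n v =>
       lext (fun s : {mset nat}%mset =>
         foldr (normal_product (heis_mode k))
               (fun n v => if n == -1 then v else 0) (enum_mset s) n v) u)
    << mset0 >>
    ((2%:R * k)^-1 *: << [mset 0; 0]%mset >>).

(* A lattice of rank one is the group Z with a biadditive form. *)
Definition posdef_even_lattice (B : int -> int -> int) : Prop :=
  [/\ forall a b c, B (a + b) c = B a c + B b c,
      forall a b, B a b = B b a,
      forall a, a != 0 -> 0 < B a a &
      forall a, (2 %| B a a)%Z].

(* M(1, 0) \otimes C[L]: the pair (s, a) stands for s \otimes e^a. *)
Definition lattice_space (F : fieldType) := {malg F[({mset nat}%mset * int)%type]}.

Definition tens (F : fieldType) (x : fock F) (a : int) : lattice_space F :=
  lext (fun s : {mset nat}%mset => << (s, a) >>) x.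

(* The coefficient of z^r in exp (\sum_(n >= 1) A_n z^n): [pow_coef A j r] is
   that of the j-th power of the series. *)
Fixpoint pow_coef (F : fieldType) (W : lmodType F) (A : nat -> W -> W)
    (j r : nat) (w : W) : W :=
  match j with
  | 0 => if r == 0%N then w else 0
  | j'.+1 => \sum_(1 <= n < r.+1) A n (pow_coef A j' (r - n) w)
  end.

Definition exp_coef (F : fieldType) (W : lmodType F) (A : nat -> W -> W)
    (r : nat) (w : W) : W :=
  \sum_(0 <= j < r.+1) (j`!)%:R^-1 *: pow_coef A j r w.

Section LatticeVOA.
Variables (F : fieldType) (B : int -> int -> int).

(* From now on gamma is the generator 1 of L = Z, and a \in L is a gamma. *)
Let k : F := (B 1 1)%:~R.

Definition lattice_mode (n : int) : lattice_space F -> lattice_space F :=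
  lext (fun b : {mset nat}%mset * int =>
    if n == 0 then (B 1 b.2)%:~R *: << b >>
    else tens (heis_mode k n << b.1 >>) b.2).

(* The coefficients in exp (\sum_(n >= 1) a(-n) z^n / n) and in
   exp (- \sum_(n >= 1) a(n) z^(-n) / n) of z^r and z^(-r), respectively. *)
Definition exp_minus (a : int) (r : nat) : fock F -> fock F :=
  exp_coef (fun n x => (a%:~R / n%:R) *: heis_mode k (- n%:Z) x) r.
Definition exp_plus (a : int) (r : nat) : fock F -> fock F :=
  exp_coef (fun n x => - (a%:~R / n%:R) *: heis_mode k n%:Z x) r.

(* The coefficient of z^(- n - 1) in Y(e^a, z), where Y(e^a, z) maps
   x \otimes e^b to
     exp (\sum_(n >= 1) a(-n) z^n / n) exp (- \sum_(n >= 1) a(n) z^(-n) / n) x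
       \otimes z^(a, b) e^(a + b).
   No cocycle is needed: an even form of rank one takes only even values. *)
Definition exp_mode (a : int) (n : int) : lattice_space F -> lattice_space F :=
  lext (fun b : {mset nat}%mset * int =>
    \sum_(r \in [set r : nat * nat |
                  r.1%:Z - r.2%:Z + B a b.2 = - n - 1])
       tens (exp_minus a r.1 (exp_plus a r.2 << b.1 >>)) (a + b.2)).

Definition latticeVOA : vertexData F :=
  @VertexData F (lattice_space F)
    (fun u n v =>
       lext (fun b : {mset nat}%mset * int =>
         foldr (normal_product lattice_mode) (exp_mode b.2)
               (enum_mset b.1) n v) u)
    (tens << mset0 >> 0)
    (tens ((2%:R * k)^-1 *: << [mset 0; 0]%mset >>) 0).

End LatticeVOA.

(* Main.v *)
Require Import Defs.
From HB Require Import structures.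
From mathcomp Require Import all_boot all_order all_algebra.
From mathcomp Require Import finmap multiset monalg complex.
From mathcomp Require Import boolp classical_sets cardinality fsbigop reals.
From mathcomp Require Import zify ring.

(* By invariance of the form alpha_1 alpha is a nonzero real multiple of the
   vacuum, and alpha rescales to h with h_1 h = 1, phi h = - h and h_n adjoint
   to h_(- n).  Then omega - (1/2) h_(-1) h is the conformal vector of central
   charge 0 commuting with h, and its norm is 0, so omega = (1/2) h_(-1) h.
   Hence a vector killed by h_n, n > 0, with h_0-eigenvalue a has weight
   a^2 / 2, and V is spanned by the h_(- n1) ... h_(- nr) x for such x: the
   orthogonal projection of V_n off the sum of the h_(- m) V_(n - m) consists
   of such vectors.

   For x and y of charges a and b the leading coefficient x * y of
   Y(x, z) y is nonzero by simplicity, has charge a + b, and stands at z^(a b)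
   by comparing weights.  So the charges form a group on which a^2 / 2 takes
   values in the natural numbers (closed under opposites because of phi): it is
   0 or infinite cyclic.  The Borcherds identity makes * associative, and the
   vectors of charge 0 are the multiples of the vacuum, so in the second case
   the powers E_i of a generator are a basis of the charged vectors with
   E_i * E_j = E_(i + j), without any cocycle.

   The map from the model to V sending a monomial in gamma(- n), tensor e^i, to
   the same monomial applied to E_i is injective since the images are
   orthogonal.  It commutes with the modes: normally ordered products come from
   the Borcherds identity, and Y(E_i, z) is computed from its commutators with
   h_n and from L(-1) E_i, which amounts to a first order differential
   equation solved by the exponential. *)

Set Implicit Arguments.
Unset Strict Implicit.
Unset Printing Implicit Defensive.
Import Order.TTheory GRing.Theory Num.Theory.
Local Open Scope ring_scope.

(** * Finite sums and binomial coefficients *)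

Section LinearFunctions.
Variables (F : fieldType) (U V : lmodType F) (f : U -> V).
Hypothesis fL : linear f.

Let g : {linear U -> V} := HB.pack f (GRing.isLinear.Build F U V *:%R f fL).

Lemma lin0 : f 0 = 0. Proof. exact: (linear0 g). Qed.
Lemma linD : {morph f : x y / x + y}. Proof. exact: (linearD g). Qed.
Lemma linB : {morph f : x y / x - y}. Proof. exact: (linearB g). Qed.
Lemma linN : {morph f : x / - x}. Proof. exact: (linearN g). Qed.
Lemma linZ a : {morph f : x / a *: x}. Proof. by move=> x; exact: (linearZ_LR g). Qed.
Lemma lin_sum I (r : seq I) (P : pred I) (E : I -> U) :
  f (\sum_(i <- r | P i) E i) = \sum_(i <- r | P i) f (E i).
Proof. exact: (linear_sum g). Qed.

(** Injectivity gives [E] and its image the same support. Otherwise a family of infinite support,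
    whose sum is 0 by convention, could have an image of finite support and nonzero sum. *)
Lemma lin_fsum (I : choiceType) (A : set I) (E : I -> U) :
  injective f -> f (\sum_(i \in A) E i) = \sum_(i \in A) f (E i).
Proof.
move=> f_inj; rewrite lin_sum; congr bigop.
rewrite /finite_support; congr (locked_with _ (fset_set (_ `&` _))).
rewrite predeqE => i /=; split=> Ei e; apply: Ei; last by rewrite e lin0.
by apply: f_inj; rewrite e lin0.
Qed.

End LinearFunctions.

Lemma fsum_nat (V : zmodType) (f : nat -> V) (K : nat) :
  (forall i, (K <= i)%N -> f i = 0) ->
  \sum_(i \in [set: nat]) f i = \sum_(i < K) f i.
Proof.
move=> f0; rewrite fsbig_ord; apply/esym/fsbig_widen => // i [_ /= /negP].
by rewrite -leqNgt => /f0.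
Qed.

Lemma big_ord_widen0 (V : zmodType) (f : nat -> V) (K L : nat) : (K <= L)%N ->
  (forall i, (K <= i)%N -> f i = 0) -> \sum_(i < L) f i = \sum_(i < K) f i.
Proof.
move=> KL f0; rewrite (big_ord_widen _ _ KL) [RHS]big_mkcond.
by apply: eq_bigr => i _; case: ltnP => // /f0.
Qed.

Section Binomial.
Variable F : numFieldType.

Lemma binz0r (z : int) : binz F z 0 = 1.
Proof. by rewrite /binz big_ord0 divr1. Qed.

Lemma binz_nat (n j : nat) : binz F n%:Z j = 'C(n, j)%:R.
Proof.
apply: (@mulIf _ (j`!)%:R); first by rewrite pnatr_eq0 -lt0n fact_gt0.
rewrite /binz mulfVK; last by rewrite pnatr_eq0 -lt0n fact_gt0.
rewrite -natrM bin_ffact ffact_prod natr_prod.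
have [le_jn|lt_nj] := leqP j n.
  by apply: eq_bigr => i _; rewrite subzn // (leq_trans _ le_jn) // ltnW.
rewrite (bigD1 (Ordinal lt_nj)) //= subrr mul0r.
by rewrite (bigD1 (Ordinal lt_nj)) //= subnn mul0r.
Qed.

(** Up to sign, the factors - n - 1 - i in reverse order are those of the falling factorial of n +
    j. *)
Lemma binzN (n j : nat) : binz F (- n%:Z - 1) j = (-1) ^+ j * 'C(n + j, j)%:R.
Proof.
apply: (@mulIf _ (j`!)%:R); first by rewrite pnatr_eq0 -lt0n fact_gt0.
rewrite /binz mulfVK; last by rewrite pnatr_eq0 -lt0n fact_gt0.
rewrite -mulrA -natrM bin_ffact ffact_prod natr_prod.
have -> : (-1) ^+ j = \prod_(i < j) (-1 : F) by rewrite prodr_const card_ord.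
rewrite -big_split /= [RHS](reindex_inj rev_ord_inj) /=.
apply: eq_bigr => i _; rewrite mulN1r pmulrn -rmorphN /=; congr (_%:~R).
by have := ltn_ord i; lia.
Qed.

End Binomial.

(** * Consequences of the Borcherds identity *)

Section FormalCalculus.
Variables (F : numClosedFieldType) (V : vertexData F) (c : F).
Hypothesis HV : is_VOA V c.
Implicit Types (u v w x : V) (l m n : int).

Lemma mode0l n v : mode (0 : V) n v = 0.
Proof. exact: (lin0 (va_linl HV n v)). Qed.
Lemma modeDl u u' n v : mode (u + u') n v = mode u n v + mode u' n v.
Proof. exact: (linD (va_linl HV n v)). Qed.
Lemma modeNl u n v : mode (- u) n v = - mode u n v.
Proof. exact: (linN (va_linl HV n v)). Qed.
Lemma modeZl a u n v : mode (a *: u) n v = a *: mode u n v.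
Proof. exact: (linZ (va_linl HV n v)). Qed.
Lemma mode0r u n : mode u n (0 : V) = 0.
Proof. exact: (lin0 (va_linr HV n u)). Qed.
Lemma modeDr u n v v' : mode u n (v + v') = mode u n v + mode u n v'.
Proof. exact: (linD (va_linr HV n u)). Qed.
Lemma modeBr u n v v' : mode u n (v - v') = mode u n v - mode u n v'.
Proof. exact: (linB (va_linr HV n u)). Qed.
Lemma modeZr a u n v : mode u n (a *: v) = a *: mode u n v.
Proof. exact: (linZ (va_linr HV n u)). Qed.
Lemma mode_sumr I (r : seq I) (P : pred I) (E : I -> V) u n :
  mode u n (\sum_(i <- r | P i) E i) = \sum_(i <- r | P i) mode u n (E i).
Proof. exact: (lin_sum (va_linr HV n u)). Qed.

Lemma mode_trunc u v l :
  exists K, forall i : nat, (K <= i)%N -> mode u (l + i%:Z) v = 0.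
Proof.
have [N hN] := va_trunc HV u v; exists `|N - l|%N => i Ki.
by apply: hN; lia.
Qed.

(** A single threshold truncates both sides. Allowing every larger K lets each use take K large
    enough first and then cut the two sides at their own bounds. *)
Lemma borcherds_fin u v w l m n : exists K0, forall K, (K0 <= K)%N ->
  \sum_(i < K) binz F m i *: mode (mode u (l + i%:Z) v) (m + n - i%:Z) w =
  \sum_(i < K) ((-1) ^+ i * binz F l i) *:
    (mode u (l + m - i%:Z) (mode v (n + i%:Z) w) -
     (-1) ^ l *: mode v (l + n - i%:Z) (mode u (m + i%:Z) w)).
Proof.
have [K1 h1] := mode_trunc u v l; have [K2 h2] := mode_trunc v w n.
have [K3 h3] := mode_trunc u w m; exists (maxn K1 (maxn K2 K3)) => K.
rewrite !geq_max => /and3P[K1K K2K K3K].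
have := va_borcherds HV u v w l m n.
rewrite (fsum_nat (K := K)) => [->|i Ki]; last first.
  by rewrite h1 ?mode0l ?scaler0 // (leq_trans K1K).
rewrite (fsum_nat (K := K)) // => i Ki.
rewrite h2 ?(leq_trans K2K) // h3 ?(leq_trans K3K) //.
by rewrite !mode0r scaler0 subrr scaler0.
Qed.

(** The case l = 0 of the Borcherds identity: [binz F 0 i] leaves only i = 0 on the right. *)
Lemma commutator u v w m n K : (forall i : nat, (K <= i)%N -> mode u i%:Z v = 0) ->
  mode u m (mode v n w) - mode v n (mode u m w) =
  \sum_(i < K) binz F m i *: mode (mode u i%:Z v) (m + n - i%:Z) w.
Proof.
move=> hK; have [K0 hK0] := borcherds_fin u v w 0 m n.
have := hK0 (maxn K0 (maxn K 1)); rewrite leq_maxl => /(_ isT).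
set L := maxn _ _; have KL : (K <= L)%N by rewrite /L; lia.
have L1 : (1 <= L)%N by rewrite /L; lia.
rewrite (@big_ord_widen0 _ (fun i => binz F m i *:
   mode (mode u (0 + i%:Z) v) (m + n - i%:Z) w) K) //; last first.
  by move=> i Ki; rewrite add0r hK // mode0l scaler0.
rewrite (@big_ord_widen0 _ (fun i => ((-1) ^+ i * binz F 0 i) *:
    (mode u (0 + m - i%:Z) (mode v (n + i%:Z) w) -
     (-1) ^ 0 *: mode v (0 + n - i%:Z) (mode u (m + i%:Z) w))) 1) //; last first.
  by case=> // i _; rewrite (binz_nat F 0) bin0n mulr0 scale0r.
rewrite big_ord1 /=; change (Posz 0) with (0 : int).
rewrite binz0r expr0 mulr1 scale1r expr0z scale1r !add0r !subr0 ?addr0.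
by move=> <-; apply: eq_bigr => i _; rewrite add0r.
Qed.

Lemma commutator_nat u v w (m : nat) n :
  mode u m%:Z (mode v n w) - mode v n (mode u m%:Z w) =
  \sum_(i < m.+1) 'C(m, i)%:R *: mode (mode u i%:Z v) (m%:Z + n - i%:Z) w.
Proof.
have [K hK] := mode_trunc u v 0.
rewrite (@commutator _ _ _ _ _ (maxn K m.+1)); last first.
  by move=> i; rewrite geq_max => /andP[/hK]; rewrite add0r.
rewrite (@big_ord_widen0 _ (fun i => binz F m i *:
   mode (mode u i%:Z v) (m%:Z + n - i%:Z) w) m.+1) ?leq_maxr //.
  by apply: eq_bigr => i _; rewrite binz_nat.
by move=> i mi; rewrite binz_nat bin_small // scale0r.
Qed.

(** The case m = 0, l = - p - 1 of the Borcherds identity: only i = 0 survives on the left, and the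
    signs of [binzN] cancel those of the expansion. *)
Lemma associator u v w (p : nat) n K :
  (forall i : nat, (K <= i)%N -> mode v (n + i%:Z) w = 0) ->
  (forall i : nat, (K <= i)%N -> mode u i%:Z w = 0) ->
  mode (mode u (- p%:Z - 1) v) n w =
  \sum_(i < K) 'C(p + i, p)%:R *:
    (mode u (- p%:Z - 1 - i%:Z) (mode v (n + i%:Z) w) +
     (-1) ^+ p *: mode v (n - p%:Z - 1 - i%:Z) (mode u i%:Z w)).
Proof.
move=> hv hu; have [K0 hK0] := borcherds_fin u v w (- p%:Z - 1) 0 n.
have := hK0 (maxn K0 (maxn K 1)); rewrite leq_maxl => /(_ isT).
set L := maxn _ _; have KL : (K <= L)%N by rewrite /L; lia.
have L1 : (1 <= L)%N by rewrite /L; lia.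
rewrite (@big_ord_widen0 _ (fun i => binz F 0 i *:
   mode (mode u (- p%:Z - 1 + i%:Z) v) (0 + n - i%:Z) w) 1) //; last first.
  by case=> // i _; rewrite (binz_nat F 0) bin0n scale0r.
rewrite (@big_ord_widen0 _ (fun i => ((-1) ^+ i * binz F (- p%:Z - 1) i) *:
    (mode u (- p%:Z - 1 + 0 - i%:Z) (mode v (n + i%:Z) w) -
     (-1) ^ (- p%:Z - 1) *: mode v (- p%:Z - 1 + n - i%:Z)
       (mode u (0 + i%:Z) w))) K) //; last first.
  by move=> i Ki; rewrite add0r hv // hu // !mode0r scaler0 subrr scaler0.
rewrite big_ord1 /= binz0r scale1r add0r subr0 ?addr0 => ->.
apply: eq_bigr => i _; rewrite binzN mulrA -expr2 sqrr_sign mul1r.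
rewrite -[in LHS]bin_sub ?leq_addl // addnK.
congr (_ *: (_ + _)).
rewrite add0r -scaleNr; congr (_ *: mode v _ _); last by lia.
have -> : - p%:Z - 1 = - (p.+1)%:Z by lia.
by rewrite -exprnN invr_sign exprS mulN1r opprK.
Qed.

(* In place of L(-1)^i y / i! this has the equal vector y_(- 1 - i) 1. *)
Lemma skew_symmetry u v l K :
  (forall i : nat, (K <= i)%N -> mode u (l + i%:Z) v = 0) ->
  mode v l u = - (-1) ^ l *:
    \sum_(i < K) (-1) ^+ i *: mode (mode u (l + i%:Z) v) (- 1 - i%:Z) vac.
Proof.
(* With w = 1, m = -1, n = 0 the creation property kills everything on the right except u_(-1) 1 at
   i = 0. *)
move=> hK; have [K0 hK0] := borcherds_fin u v vac l (-1) 0.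
have := hK0 (maxn K0 (maxn K 1)); rewrite leq_maxl => /(_ isT).
set L := maxn _ _; have KL : (K <= L)%N by rewrite /L; lia.
have L1 : (1 <= L)%N by rewrite /L; lia.
rewrite (@big_ord_widen0 _ (fun i => binz F (-1) i *:
   mode (mode u (l + i%:Z) v) (-1 + 0 - i%:Z) vac) K) //; last first.
  by move=> i Ki; rewrite hK // mode0l scaler0.
rewrite (@big_ord_widen0 _ (fun i => ((-1) ^+ i * binz F l i) *:
    (mode u (l - 1 - i%:Z) (mode v (0 + i%:Z) vac) -
     (-1) ^ l *: mode v (l + 0 - i%:Z) (mode u (-1 + i%:Z) vac))) 1) //; last first.
  case=> // i _; rewrite (va_creation HV v).2 ?mode0r; last by lia.
  rewrite (va_creation HV u).2 ?mode0r; last by lia.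
  by rewrite scaler0 subrr scaler0.
rewrite big_ord1 /=; change (Posz 0) with (0 : int).
rewrite binz0r mulr1 scale1r !subr0 ?addr0.
rewrite (va_creation HV v).2 // mode0r sub0r (va_creation HV u).1.
have -> : \sum_(i < K) binz F (-1) i *: mode (mode u (l + i%:Z) v) (-1 - i%:Z) vac
  = \sum_(i < K) (-1) ^+ i *: mode (mode u (l + i%:Z) v) (- 1 - i%:Z) vac.
  by apply: eq_bigr => i _; rewrite -[-1]sub0r -[0]oppr0 binzN binn mulr1.
move=> ->; rewrite scalerN scaleNr opprK scalerA -expfzMl mulrNN mulr1.
by rewrite exp1rz scale1r.
Qed.

Lemma homogeneous_lin n a v w :
  homogeneous n v -> homogeneous n w -> homogeneous n (a *: v + w).
Proof.
rewrite /homogeneous /vir => hv hw.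
by rewrite modeDr modeZr hv hw scalerDr !scalerA mulrC.
Qed.

Lemma homogeneous0 n : homogeneous n (0 : V).
Proof. by rewrite /homogeneous /vir mode0r scaler0. Qed.

Lemma homogeneousZ n a v : homogeneous n v -> homogeneous n (a *: v).
Proof.
by move=> hv; rewrite -[a *: v]addr0; apply: homogeneous_lin => //; apply: homogeneous0.
Qed.

Lemma homogeneousD n v w : homogeneous n v -> homogeneous n w -> homogeneous n (v + w).
Proof. by move=> hv hw; rewrite -[v]scale1r; apply: homogeneous_lin. Qed.

Lemma homogeneousB n v w : homogeneous n v -> homogeneous n w -> homogeneous n (v - w).
Proof.
by move=> hv hw; apply: homogeneousD => //; rewrite -scaleN1r; apply: homogeneousZ.
Qed.

Lemma vir0_mode v n w :
  vir 0 (mode v n w) =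
  mode (vir 0 v) n w + mode v n (vir 0 w) - (n + 1)%:~R *: mode v n w.
Proof.
rewrite /vir; apply/eqP; rewrite addrAC -subr_eq; apply/eqP.
rewrite (commutator_nat conf v w 1 n) big_ord_recl big_ord1 /= bin0 bin1 !scale1r.
rewrite -[mode conf 0 v]/(vir (-1) v) (voa_derivative HV) addrC.
congr (_ + mode _ _ _); last by rewrite /bump /=; lia.
by rewrite -scaleNr; congr (- _%:~R *: mode _ _ _); lia.
Qed.

Lemma homogeneous_mode p q n v w :
  homogeneous p v -> homogeneous q w -> homogeneous (p + q - n - 1) (mode v n w).
Proof.
rewrite /homogeneous => hv hw; rewrite vir0_mode hv hw modeZl modeZr -scalerDl -scalerBl.
by congr (_ *: _); rewrite -rmorphD -rmorphB /=; congr _%:~R; lia.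
Qed.

Lemma vir_vac n : -1 <= n -> vir n (vac : V) = 0.
Proof. by move=> n1; rewrite /vir (va_creation HV conf).2 //; lia. Qed.

Lemma conf_vir : conf = vir (-2) (vac : V).
Proof. by rewrite /vir (va_creation HV conf).1. Qed.

Lemma homogeneous_conf : homogeneous 2 (conf : V).
Proof.
have := voa_virasoro HV 0 (-2) vac; rewrite -conf_vir.
by rewrite [vir 0 vac]vir_vac // /vir mode0r subr0 addr0.
Qed.

Lemma vir1_conf : vir 1 (conf : V) = 0.
Proof.
have := voa_virasoro HV 1 (-2) vac; rewrite -conf_vir.
rewrite [vir 1 vac]vir_vac // [vir (1 - 2) vac]vir_vac //.
by rewrite {2}/vir mode0r subr0 scaler0 addr0.
Qed.

Lemma vir2_conf : vir 2 (conf : V) = (c / 2%:R) *: vac.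
Proof.
have := voa_virasoro HV 2 (-2) vac; rewrite -conf_vir.
rewrite [vir 2 vac]vir_vac // [vir (2 - 2) vac]vir_vac //.
rewrite {2}/vir mode0r subr0 scaler0 add0r => ->.
by congr (_ *: _); rewrite /=; field.
Qed.

Lemma vir0_eigenvalue mu x : x != 0 -> vir 0 x = mu *: x -> exists n : int, mu = n%:~R.
Proof.
move=> x0 hx; apply: contrapT => /forallNP mu_int; case/eqP: x0.
have [s [hs xs]] := voa_graded HV x.
have [k sk] : exists k, size s = k by exists (size s).
elim: k s sk hs xs => [|k IHk] [|y s] //= sk hs xs; first by rewrite xs big_nil.
move: sk xs => [sk]; rewrite big_cons => xs.
have [n hn] : exists n, homogeneous n y by apply: hs; rewrite inE eqxx.
have mun : mu - n%:~R != 0 by rewrite subr_eq0; apply/eqP.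
(* This operator fixes x, kills the homogeneous summand y and preserves homogeneity, so x is a sum
   with one term fewer. *)
pose g (z : V) := (mu - n%:~R)^-1 *: (vir 0 z - n%:~R *: z).
apply: (IHk (map g s)); first by rewrite size_map.
  move=> _ /mapP[z zs ->]; have [p hp] : exists p, homogeneous p z.
    by apply: hs; rewrite inE zs orbT.
  exists p; apply/homogeneousZ/homogeneousB; last exact: homogeneousZ.
  by rewrite hp; apply: homogeneousZ.
rewrite big_map -scaler_sumr sumrB -scaler_sumr.
apply: (scalerI mun); rewrite scalerA divff // scale1r scalerBl -hx xs.
rewrite /vir modeDr mode_sumr scalerDr [mode conf _ y]hn.
by rewrite opprD addrACA subrr add0r.
Qed.

(** The derivative property lowers the mode by one at the cost of a nonzero integer factor: y_(- 1 -
    i) 1 is L(-1)^i y / i!. *)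
Lemma mode_pow_vac (I : V -> Prop) : subspace I -> (forall y, I y -> I (vir (-1) y)) ->
  forall y (i : nat), I y -> I (mode y (- 1 - i%:Z) vac).
Proof.
move=> [I0 Ilin] IL y i; elim: i y => [|i IHi] y Iy.
  by rewrite subr0 (va_creation HV y).1.
have Iz a z : I z -> I (a *: z) by move=> Iz; rewrite -[_ *: _]addr0; apply: Ilin.
have := IHi _ (IL _ Iy); rewrite (voa_derivative HV).
have -> : - 1 - i%:Z - 1 = - 1 - i.+1%:Z by lia.
have i0 : (- (- 1 - i%:Z))%:~R != 0 :> F by rewrite intr_eq0; lia.
by move=> /(Iz (- (- 1 - i%:Z))%:~R^-1); rewrite scalerA -rmorphN mulVf ?scale1r.
Qed.

Lemma annihilator_left u x : (forall n, mode u n x = 0) ->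
  forall w n m, mode u m (mode w n x) = 0.
Proof.
move=> ux w; have [N hN] := va_trunc HV u w; have [M hM] := va_trunc HV w x.
suff h (k : nat) : forall n, M - k%:Z <= n -> forall m, mode u m (mode w n x) = 0.
  by move=> n; apply: (h `|M - n|%N); lia.
elim: k => [|k IHk] n Mn m; first by rewrite hM ?mode0r //; lia.
(* Since u_l w = 0 for l >= N, the left side vanishes. On the right, modes of u on x vanish and the
   terms i > 0 vanish by induction, which isolates u_m (w_n x). *)
have [K0 hK0] := borcherds_fin u w x N (m - N) n.
have := hK0 K0.+1 (leqnSn _); rewrite big1 => [|i _]; last first.
  by rewrite hN ?mode0l ?scaler0 //; lia.
rewrite big_ord_recl /= big1 => [|i _].
  rewrite binz0r expr0 mulr1 scale1r ux mode0r scaler0 !subr0 addr0.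
  by rewrite addrC subrK.
rewrite IHk; last by rewrite /bump /=; lia.
by rewrite ux mode0r scaler0 subr0 scaler0.
Qed.

(** The vectors annihilated by all modes of u form an ideal. It is not the whole space, since u_(-1)
    1 = u, so by simplicity it is 0. *)
Lemma simple_mode_neq0 u v : simple_VOA V -> u != 0 -> v != 0 ->
  exists n, mode u n v != 0.
Proof.
move=> [_ Vsimple] u0 v0; pose I x := forall n, mode u n x = 0.
have Isub : subspace I.
  split=> [n|a x y Ix Iy n]; first exact: mode0r.
  by rewrite modeDr modeZr Ix Iy scaler0 addr0.
have IL x w n : I x -> I (mode w n x) by move=> Ix m; apply: annihilator_left.
have Iideal : ideal I.
  split=> // w x n Ix; split; first exact: IL.
  have [K hK] := mode_trunc w x n.
  (* Skew symmetry writes x_n w through (w_(n + i) x)_(- 1 - i) 1, where w_(n + i) x already lies in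
     the left ideal [I], which is stable under L(-1). *)
  rewrite (skew_symmetry hK) => m; rewrite modeZr mode_sumr big1 ?scaler0 // => i _.
  have IL1 y : I y -> I (vir (-1) y) by apply: IL.
  by rewrite modeZr (mode_pow_vac Isub IL1 i (IL _ _ _ Ix)) scaler0.
have [I0|IT] := Vsimple I Iideal.
  apply: contrapT => /forallNP uv; case/eqP: v0; apply: I0 => n.
  by apply/eqP; apply: contraT => /uv.
by case/eqP: u0; rewrite -(va_creation HV u).1 IT.
Qed.

End FormalCalculus.

(** * Hermitian forms and adjoints *)

Section Hermitian.
Variables (C : numClosedFieldType) (V : lmodType C) (form : V -> V -> C).
Hypothesis Hform : posdef_hermitian form.
Implicit Types u v w : V.

Lemma formDl u v w : form (u + v) w = form u w + form v w.
Proof. by case: Hform => hl _ _; rewrite -[u]scale1r hl mul1r scale1r. Qed.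
Lemma form0l w : form 0 w = 0.
Proof. by apply: (@addrI _ (form 0 w)); rewrite -formDl !addr0. Qed.
Lemma formZl a u w : form (a *: u) w = a * form u w.
Proof. by case: Hform => hl _ _; rewrite -[a *: u]addr0 hl form0l addr0. Qed.
Lemma formNl u w : form (- u) w = - form u w.
Proof. by rewrite -scaleN1r formZl mulN1r. Qed.
Lemma formBl u v w : form (u - v) w = form u w - form v w.
Proof. by rewrite formDl formNl. Qed.
Lemma form_suml I (r : seq I) (P : pred I) (E : I -> V) w :
  form (\sum_(i <- r | P i) E i) w = \sum_(i <- r | P i) form (E i) w.
Proof.
elim/big_rec2: _ => [|i x y _ <-]; [exact: form0l|exact: formDl].
Qed.
Lemma formC u v : form v u = (form u v)^*.
Proof. by case: Hform. Qed.
Lemma form0r w : form w 0 = 0.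
Proof. by rewrite formC form0l rmorph0. Qed.
Lemma formDr u v w : form w (u + v) = form w u + form w v.
Proof. by rewrite formC formDl rmorphD /= -!formC. Qed.
Lemma formZr a u w : form w (a *: u) = a^* * form w u.
Proof. by rewrite formC formZl rmorphM /= -formC. Qed.
Lemma formNr u w : form w (- u) = - form w u.
Proof. by rewrite formC formNl rmorphN /= -formC. Qed.
Lemma form_gt0 v : v != 0 -> 0 < form v v.
Proof. by case: Hform => _ _; apply. Qed.
Lemma form_eq0 v : form v v = 0 -> v = 0.
Proof. by apply: contra_eq => /form_gt0 /gt_eqF ->. Qed.

Lemma orthogonal_projection (s : seq V) v : exists a : 'I_(size s) -> C,
  forall x, x \in s -> form (v - \sum_i a i *: s`_i) x = 0.
Proof.
suff : exists a : nat -> C,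
    forall x, x \in s -> form (v - \sum_(i < size s) a i *: s`_i) x = 0.
  by move=> [a ha]; exists (fun i => a i).
elim: s v => [|y s IHs] v; first by exists (fun=> 0).
(* Gram-Schmidt: v and y are first made orthogonal to [s], then the component of [v1] along [y1] is
   removed. The list need not be independent: if [y1] is 0, any t works. *)
have [b hb] := IHs v; have [d hd] := IHs y.
set v1 := v - _ in hb; set y1 := y - _ in hd.
pose t := form v1 y1 / form y1 y1.
exists (fun i => if i is j.+1 then b j - t * d j else t) => x.
have -> : v - \sum_(i < size (y :: s))
     (if i : nat is j.+1 then b j - t * d j else t) *: (y :: s)`_i = v1 - t *: y1.
  rewrite big_ord_recl /= /v1 /y1 scalerBr scaler_sumr.
  under eq_bigr do rewrite /= scalerBl -scalerA.
  rewrite sumrB opprD !opprB addrA addrACA [RHS]addrACA.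
  by congr (_ + _); rewrite addrC.
have v1y1 : form (v1 - t *: y1) y1 = 0.
  rewrite formBl formZl /t; have [->|y1n0] := eqVneq y1 0.
    by rewrite !form0r mulr0 subr0.
  by rewrite mulfVK ?subrr // gt_eqF // form_gt0.
have orth z : z \in s -> form (v1 - t *: y1) z = 0.
  by move=> zs; rewrite formBl formZl hb // hd // mulr0 subr0.
rewrite inE => /orP[/eqP->|]; last exact: orth.
rewrite -[y](subrK (\sum_(i < size s) d i *: s`_i)) -/y1 formDr v1y1 add0r.
rewrite formC form_suml big1 ?rmorph0 // => i _.
by rewrite formZl formC orth ?mem_nth // rmorph0 mulr0.
Qed.

End Hermitian.

(** * Adjoints of modes and the normalized Heisenberg vector *)

Section UnitaryVOA.
Variables (C : numClosedFieldType) (V : vertexData C) (phi : V -> V) (form : V -> V -> C).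
Hypotheses (HV : is_VOA V 1) (HC : CFT_type V).
Hypotheses (Hphi : antilinear_automorphism phi) (Hform : posdef_hermitian form).
Hypothesis (Hinv : invariant_form phi form).
Implicit Types (u v w : V).

Lemma cft_mode_eq0 p q n v w : homogeneous p v -> homogeneous q w ->
  p + q - n - 1 < 0 -> mode v n w = 0.
Proof.
by move=> hv hw lt0; apply: (HC.1 _ _ lt0); apply: (homogeneous_mode HV).
Qed.

Lemma phiD u v : phi (u + v) = phi u + phi v.
Proof. by case: Hphi => hl _ _ _ _; rewrite -[u]scale1r hl rmorph1 !scale1r. Qed.
Lemma phi0 : phi 0 = 0.
Proof. by apply: (@addrI _ (phi 0)); rewrite -phiD !addr0. Qed.
Lemma phiZ a u : phi (a *: u) = a^* *: phi u.
Proof. by case: Hphi => hl _ _ _ _; rewrite -[a *: u]addr0 hl phi0 addr0. Qed.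
Lemma phi_mode u n v : phi (mode u n v) = mode (phi u) n (phi v).
Proof. by case: Hphi. Qed.

(** Since L(1) omega = 0, only i = 0 contributes to the invariance formula, with sign (-1)^2; so
    L(n) is adjoint to L(- n). *)
Lemma adjoint_conf n u v : form (mode conf n u) v = form u (mode conf (2 - n) v).
Proof.
have iter0 i : iter i.+1 (vir 1) (conf : V) = 0.
  by elim: i => [|i IHi]; [exact: vir1_conf HV|rewrite iterS IHi /vir (mode0r HV)].
have := Hinv u v (2 - n) (homogeneous_conf HV).
rewrite (fsum_nat (K := 1)) => [|[//|i] _]; last first.
  by rewrite iter0 (mode0l HV) scaler0.
have -> : phi conf = conf by case: Hphi.
rewrite big_ord1 /= divr1 -exprnP sqrrN expr1n scale1r => <-.
by congr (form (mode _ _ _) _); lia.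
Qed.

Lemma vac_neq0 : simple_VOA V -> vac != 0 :> V.
Proof.
move=> [[v v0] _]; apply: contraNneq v0 => vac0.
by have := va_vacuum HV (-1) v; rewrite eqxx vac0 (mode0l HV) => <-.
Qed.

Lemma form_vac_gt0 : simple_VOA V -> 0 < form vac vac.
Proof. by move/vac_neq0; apply: form_gt0. Qed.

(** L(1) a is a multiple b 1 of the vacuum. Invariance at u = v = 1, n = 0 reads - b (1, 1) = (1,
    (phi a)_0 1) = 0. *)
Lemma vir1_weight1 (a : V) : simple_VOA V -> homogeneous 1 a -> vir 1 a = 0.
Proof.
move=> Vs ha; have /(HC.2 _).1 [b hb] : homogeneous 0 (vir 1 a).
  by have := homogeneous_mode HV 2 (homogeneous_conf HV) ha.
have iter0 i : iter i.+2 (vir 1) a = 0.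
  elim: i => [|i IHi]; last by rewrite iterS IHi /vir (mode0r HV).
  by rewrite /= hb /vir (modeZr HV) [mode _ _ _](vir_vac HV) ?scaler0.
have := Hinv vac vac 0 ha.
rewrite (fsum_nat (K := 2)) => [|[//|[//|i]] _]; last first.
  by rewrite iter0 (mode0l HV) scaler0.
rewrite (va_creation HV (phi a)).2 // (form0r Hform) big_ord_recl big_ord1 /= hb.
rewrite (modeZl HV) (va_vacuum HV) (va_creation HV a).2 // scaler0 add0r.
rewrite /= divr1 scalerA (formZl Hform) expr1z mulN1r mulNr => /eqP.
by rewrite oppr_eq0 mulf_eq0 (gt_eqF (form_vac_gt0 Vs)) orbF => /eqP ->; rewrite scale0r.
Qed.

Lemma adjoint_weight1 (a : V) n u v : simple_VOA V -> homogeneous 1 a ->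
  form (mode a n u) v = - form u (mode (phi a) (- n) v).
Proof.
move=> Vs ha; have := Hinv u v (- n) ha.
have iter0 i : iter i.+1 (vir 1) a = 0.
  by elim: i => [|i IHi]; [exact: vir1_weight1|rewrite iterS IHi /vir (mode0r HV)].
rewrite (fsum_nat (K := 1)) => [|[//|i] _]; last first.
  by rewrite iter0 (mode0l HV) scaler0.
rewrite big_ord1 /= divr1 expr1z scaleN1r (formNl Hform) => <-.
by rewrite opprK; congr (form (mode _ _ _) _); lia.
Qed.

(** The sign in phi h = - h cancels the one in [adjoint_weight1], which makes h_n adjoint to h_(-
    n). It is forced by positivity once alpha is divided by a square root of [kap]. *)
Lemma normalized_heisenberg (alpha : V) (r : C) : simple_VOA V -> involutive phi ->
  alpha != 0 -> homogeneous 1 alpha -> mode alpha 0 alpha = 0 ->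
  r^* = r -> phi alpha = r *: alpha ->
  exists h : V, [/\ homogeneous 1 h, mode h 0 h = 0, mode h 1 h = vac & phi h = - h].
Proof.
move=> Vs phiK a0 ha aa rr phia.
have := homogeneous_mode HV 1 ha ha => /(HC.2 _).1 [kap hkap].
have r2 : r * r = 1.
  have := phiK alpha; rewrite phia phiZ phia scalerA rr => /eqP.
  by rewrite -subr_eq0 -{2}[alpha]scale1r -scalerBl scaler_eq0 (negPf a0) orbF subr_eq0 => /eqP.
have form_a := form_gt0 Hform a0; have form_1 := form_vac_gt0 Vs.
(* Taking adjoints in (alpha_1 alpha, 1) gives kap (1, 1) = - r (alpha, alpha), and r^2 = 1. *)
have rkap_lt0 : r * kap < 0.
  have := adjoint_weight1 1 alpha vac Vs ha; rewrite hkap phia (modeZl HV).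
  rewrite (va_creation HV alpha).1 (formZl Hform) (formZr Hform) rr => e.
  rewrite -(pmulr_llt0 _ form_1) -mulrA e mulrN mulrA r2 mul1r oppr_lt0 //.
have kap0 : kap != 0 by apply: contraTneq rkap_lt0 => ->; rewrite mulr0 ltxx.
pose s := sqrtC kap; have s2 : s * s = kap by rewrite -expr2 sqrtCK.
have s0 : s != 0 by rewrite sqrtC_eq0.
(* The number r kap is negative and has the modulus of s s^*, so r s^2 = - s s^*. *)
have rs : r * s = - s^*.
  have ss : 0 < s * s^* by rewrite -normCK exprn_gt0 // normr_gt0.
  have e1 : (r * kap) ^+ 2 = (s * s^*) ^+ 2.
    have /CrealP rkC : r * kap \is Num.real by apply: ltr0_real.
    rewrite !expr2 -{2}rkC rmorphM /= rr -s2 rmorphM /= mulrACA r2 mul1r.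
    by rewrite mulrACA.
  have /eqP := e1; rewrite eqf_sqr => /orP[/eqP e|/eqP e].
    by move: rkap_lt0; rewrite e => /(lt_trans ss); rewrite ltxx.
  by apply: (mulIf s0); rewrite mulNr [s^* * s]mulrC -e -mulrA s2.
exists (s^-1 *: alpha); split.
- exact: (homogeneousZ HV).
- by rewrite (modeZl HV) (modeZr HV) aa !scaler0.
- by rewrite (modeZl HV) (modeZr HV) hkap !scalerA -s2 -mulrA mulKf // mulVf // scale1r.
- rewrite phiZ phia scalerA -scaleNr; congr (_ *: _).
  have sC0 : s^* != 0 by rewrite fmorph_eq0.
  by apply: (mulIf s0); rewrite fmorphV -mulrA rs mulrN mulVf // mulNr mulVf.
Qed.

End UnitaryVOA.

(** * Vacuum vectors of the Heisenberg algebra *)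

Record unitary_heisenberg (C : numClosedFieldType) (V : vertexData C)
    (phi : V -> V) (form : V -> V -> C) (h : V) : Prop := UnitaryHeisenberg {
  uh_voa : is_VOA V 1;
  uh_simple : simple_VOA V;
  uh_cft : CFT_type V;
  uh_phi : antilinear_automorphism phi;
  uh_form : posdef_hermitian form;
  uh_inv : invariant_form phi form;
  uh_weight : homogeneous 1 h;
  uh_mode0 : mode h 0 h = 0;
  uh_mode1 : mode h 1 h = vac;
  uh_phih : phi h = - h }.

(** Vacuum vectors of charge a for the Heisenberg algebra of h, zero included; the word does not
    refer to the Virasoro modes here. *)
Definition primary (C : numClosedFieldType) (V : vertexData C) (h : V) (a : C) (x : V) :=
  (forall n : int, 0 < n -> mode h n x = 0) /\ mode h 0 x = a *: x.

Section Heisenberg.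
Variables (C : numClosedFieldType) (V : vertexData C) (phi : V -> V) (form : V -> V -> C).
Variable h : V.
Hypothesis HD : unitary_heisenberg phi form h.
Implicit Types (u v w x y z : V) (a b : C) (l m n : int).

Let HV := uh_voa HD.
Let HS := uh_simple HD.
Let HC := uh_cft HD.
Let Hphi := uh_phi HD.
Let Hform := uh_form HD.
Let Hinv := uh_inv HD.
Let h_weight := uh_weight HD.
Let h_mode1 := uh_mode1 HD.

Lemma heis_adjoint n u v : form (mode h n u) v = form u (mode h (- n) v).
Proof.
rewrite (adjoint_weight1 HV HC Hform Hinv) // (uh_phih HD).
by rewrite (modeNl HV) (formNr Hform) opprK.
Qed.

Lemma heis_small (i : nat) : (2 <= i)%N -> mode h i%:Z h = 0.
Proof. by move=> i2; apply: (cft_mode_eq0 HV HC h_weight h_weight); lia. Qed.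

Lemma heis_commutator m n w :
  mode h m (mode h n w) - mode h n (mode h m w) =
  if m + n == 0 then m%:~R *: w else 0.
Proof.
rewrite (@commutator _ _ _ HV h h w m n 2 heis_small) big_ord_recl big_ord1 /=.
rewrite (uh_mode0 HD) (mode0l HV) scaler0 add0r h_mode1 (va_vacuum HV).
have -> : (m + n - (bump 0 0)%:Z == -1) = (m + n == 0) by rewrite /bump /=; lia.
by case: ifP; rewrite ?scaler0 // /binz big_ord1 subr0 divr1.
Qed.

(** The difference u has (u, u) = (1, L(2) u) - (1/2) (h, h_1 u). Both L(2) u and h_1 u vanish, the
    former because c / 2 = 1 / 2. *)
Lemma conf_heis : conf = 2%:R^-1 *: mode h (-1) h.
Proof.
pose u : V := conf - 2%:R^-1 *: mode h (-1) h.
suff u0 : form u u = 0 by apply/eqP; rewrite -subr_eq0; apply/eqP/(form_eq0 Hform u0).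
have L2hh : mode conf 3 (mode h (-1) h) = vac.
  have h3 : mode conf 3 h = 0.
    by apply: (cft_mode_eq0 HV HC (homogeneous_conf HV) h_weight).
  have := commutator_nat HV conf h h 3 (-1).
  rewrite h3 (mode0r HV) subr0 => ->.
  rewrite !big_ord_recl big_ord0 /= /bump /= h3 (mode0l HV) scaler0 !addr0.
  rewrite -[mode conf 2 h]/(vir 1 h) (vir1_weight1 HV HC Hform Hinv) //.
  rewrite (mode0l HV) scaler0 addr0.
  rewrite -[mode conf 0 h]/(vir (-1) h) (voa_derivative HV).
  rewrite -[mode conf 1 h]/(vir 0 h) h_weight.
  have -> : 3%:Z - 1 - 1 = 1 by [].
  rewrite mulr1z addn0 bin1 (_ : 3%:Z - 1 = 2) //.
  by rewrite bin0 !scale1r h_mode1 -scalerDl -[RHS]scale1r; congr (_ *: _); ring.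
have h1conf : mode h 1 conf = h.
  rewrite (@skew_symmetry _ _ _ HV conf h 1 1); last first.
    move=> [|[|i]] // _; first exact: (vir1_weight1 HV HC Hform Hinv).
    by apply: (cft_mode_eq0 HV HC (homogeneous_conf HV) h_weight); lia.
  rewrite big_ord1 expr1z opprK !scale1r -[mode conf _ h]/(vir 0 h) h_weight scale1r.
  by rewrite (va_creation HV h).1.
have h1hh : mode h 1 (mode h (-1) h) = h + h.
  have := heis_commutator 1 (-1) h; rewrite h_mode1 (va_creation HV h).1 /=.
  by rewrite scale1r => /eqP; rewrite subr_eq => /eqP.
rewrite {1}/u (formBl Hform) (formZl Hform) heis_adjoint.
have -> : form conf u = form vac (mode conf 3 u).
  by rewrite -{1}(va_creation HV conf).1 (adjoint_conf HV Hphi).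
rewrite /u !(modeBr HV) !(modeZr HV) L2hh h1conf h1hh.
rewrite -[mode conf 3 conf]/(vir 2 conf) (vir2_conf HV) mul1r subrr (form0r Hform).
rewrite -mulr2n -scaler_nat scalerA mulVf ?pnatr_eq0 // scale1r subrr (form0r Hform).
by rewrite mulr0 subr0.
Qed.

Lemma conf_mode n v : mode conf n v = 2%:R^-1 *: mode (mode h (-1) h) n v.
Proof. by rewrite {1}conf_heis (modeZl HV). Qed.

Lemma primary_lin a b x y : primary h a x -> primary h a y -> primary h a (b *: x + y).
Proof.
move=> [hx h0x] [hy h0y]; split=> [n n0|].
  by rewrite (modeDr HV) (modeZr HV) hx // hy // scaler0 addr0.
by rewrite (modeDr HV) (modeZr HV) h0x h0y scalerDr !scalerA mulrC.
Qed.

Lemma primary0 a : primary h a (0 : V).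
Proof. by split=> [n _|]; rewrite (mode0r HV) ?scaler0. Qed.

Lemma primaryZ a b x : primary h a x -> primary h a (b *: x).
Proof. by move=> hx; rewrite -[b *: x]addr0; apply: primary_lin => //; apply: primary0. Qed.

Lemma primary_vac : primary h 0 (vac : V).
Proof. by split=> [n n0|]; rewrite (va_creation HV h).2 ?scale0r // ltW. Qed.

Lemma primary_vir0 a x : primary h a x -> vir 0 x = (a ^+ 2 / 2%:R) *: x.
Proof.
move=> [hx h0x]; rewrite /vir conf_mode (@associator _ _ _ HV h h x 0 1 1).
- rewrite big_ord1 bin0 expr0 !scale1r h0x (modeZr HV) h0x hx // (mode0r HV) add0r.
  by rewrite !scalerA; congr (_ *: _); field.
- by move=> i i1; apply: hx; lia.
- by move=> i i1; apply: hx; lia.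
Qed.

(** The terms h_(-1) h_0 x occur twice in the normally ordered square, which absorbs the factor
    1/2. *)
Lemma primary_vir_m1 a x : primary h a x -> vir (-1) x = a *: mode h (-1) x.
Proof.
move=> [hx h0x]; rewrite /vir conf_mode (@associator _ _ _ HV h h x 0 0 1).
- rewrite big_ord1 bin0 expr0 !scale1r h0x (modeZr HV) /=.
  by rewrite -scalerDl scalerA; congr (_ *: _); field.
- by move=> i i1; apply: hx; lia.
- by move=> i i1; apply: hx; lia.
Qed.

Lemma homogeneous_inj x m n : x != 0 -> homogeneous m x -> homogeneous n x -> m = n.
Proof.
move=> x0 hm; rewrite /homogeneous hm => /eqP.
by rewrite -subr_eq0 -scalerBl scaler_eq0 (negPf x0) orbF subr_eq0 eqr_int => /eqP.
Qed.

(** The L(0)-eigenvalue a^2 / 2 is an integer by the grading and nonnegative by CFT type. *)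
Lemma primary_weight a x : primary h a x -> x != 0 ->
  exists p : nat, a ^+ 2 = (2 * p)%:R /\ homogeneous p x.
Proof.
move=> px x0; have hx := primary_vir0 px.
have [n an] := vir0_eigenvalue HV x0 hx; rewrite an in hx.
have n0 : 0 <= n by rewrite leNgt; apply: contra x0 => n0; apply/eqP/(HC.1 _ _ n0 hx).
case: n n0 an hx => // p _ an hx; exists p; split=> //.
by rewrite natrM [p%:R]pmulrn -an mulrC mulfVK ?pnatr_eq0.
Qed.

Lemma primary_vacuum x : primary h 0 x -> exists b, x = b *: vac.
Proof.
by move/primary_vir0; rewrite expr0n mul0r => hx; apply/(HC.2 x).
Qed.

Lemma primary_real a x : primary h a x -> x != 0 -> a \is Num.real.
Proof.
move=> px x0; have [p [ap _]] := primary_weight px x0.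
have : a ^+ 2 = (sqrtC (2 * p)%:R) ^+ 2 by rewrite sqrtCK.
have sR : sqrtC (2 * p)%:R \is @Num.real C by apply: ger0_real; rewrite sqrtC_ge0 ler0n.
by move/eqP; rewrite eqf_sqr => /orP[]/eqP ->; rewrite ?rpredN.
Qed.

Lemma primary_phi a x : primary h a x -> x != 0 -> primary h (- a) (phi x).
Proof.
move=> px x0; have /CrealP aR := primary_real px x0.
have hphi n y : mode h n (phi y) = - phi (mode h n y).
  by rewrite (phi_mode Hphi) (uh_phih HD) (modeNl HV) opprK.
case: px => hx h0x; split=> [n n0|]; first by rewrite hphi hx // (phi0 Hphi) oppr0.
by rewrite hphi h0x (phiZ Hphi) aR scaleNr.
Qed.

Lemma heis_primary a x m n y : primary h a x ->
  mode h m (mode x n y) = mode x n (mode h m y) + a *: mode x (m + n) y.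
Proof.
move=> [hx h0x]; apply/eqP; rewrite addrC -subr_eq; apply/eqP.
rewrite (@commutator _ _ _ HV h x y m n 1) => [|i i1]; last by apply: hx; lia.
by rewrite big_ord1 binz0r scale1r h0x (modeZl HV) subr0.
Qed.

(** Simplicity provides a nonzero x_n y and truncation a largest such n. Commuting h_m past x only
    raises the mode of x, so the leading coefficient is again a vacuum vector. *)
Lemma primary_top a b x y : primary h a x -> primary h b y -> x != 0 -> y != 0 ->
  exists n, [/\ a * b = (- n - 1)%:~R, mode x n y != 0,
    primary h (a + b) (mode x n y) & forall n', n < n' -> mode x n' y = 0].
Proof.
move=> px py x0 y0; have [N hN] := va_trunc HV x y.
have [k k0] : exists k : nat, mode x (N - k%:Z) y != 0.
  have [n n0] := simple_mode_neq0 HV HS x0 y0; exists `|N - n|%N.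
  have nN : n < N by rewrite ltNge; apply: contra n0 => /hN ->.
  by rewrite (_ : _ - _ = n) //; lia.
have [{k0}k k0 kmin] := ex_minnP (ex_intro (fun k : nat => mode x (N - k%:Z) y != 0) k k0).
have [n nE] : exists n, n = N - k%:Z by exists (N - k%:Z).
rewrite -nE in k0.
have ntop n' : n < n' -> mode x n' y = 0.
  move=> nn'; have [/hN //|n'N] := leP N n'.
  apply/eqP; apply: contraT; have -> : n' = N - `|N - n'|%N%:Z by lia.
  by move/kmin; lia.
have pxy : primary h (a + b) (mode x n y).
  split=> [m m0|]; rewrite (heis_primary _ n y px).
    by rewrite py.1 // (mode0r HV) add0r ntop ?scaler0 //; lia.
  by rewrite py.2 (modeZr HV) add0r -scalerDl addrC.
exists n; split=> //.
have [p [ap hp]] := primary_weight px x0; have [q [bq hq]] := primary_weight py y0.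
have [r [abr hr]] := primary_weight pxy k0.
(* Equating the weights (a + b)^2 / 2 and a^2 / 2 + b^2 / 2 - n - 1 yields a b = - n - 1. *)
have rpq := homogeneous_inj k0 hr (homogeneous_mode HV n hp hq).
have rpqC := congr1 (fun n => n%:~R : C) rpq.
move: abr rpqC; rewrite sqrrD ap bq !natrM !rmorphB rmorphD /= !rmorphN /= -!pmulrn.
move=> e1 e2; apply: (@mulfI _ 2%:R); first by rewrite pnatr_eq0.
have -> : 2%:R * (a * b) = 2%:R * r%:R - 2%:R * p%:R - 2%:R * q%:R by rewrite -e1; ring.
by rewrite e2; ring.
Qed.

(** The charges determine the leading exponent; with n prescribed by a b, this and the next lemma
    also cover zero vectors. *)
Lemma primary_mode_eq0 a b x y n n' : primary h a x -> primary h b y ->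
  a * b = (- n - 1)%:~R -> n < n' -> mode x n' y = 0.
Proof.
move=> px py abn nn'; have [->|x0] := eqVneq x 0; first by rewrite (mode0l HV).
have [->|y0] := eqVneq y 0; first by rewrite (mode0r HV).
have [m [abm _ _]] := primary_top px py x0 y0; apply.
by move: abm; rewrite abn => /eqP; rewrite eqr_int => /eqP; lia.
Qed.

Lemma primary_mode a b x y n : primary h a x -> primary h b y ->
  a * b = (- n - 1)%:~R -> primary h (a + b) (mode x n y).
Proof.
move=> px py abn; have [->|x0] := eqVneq x 0; first by rewrite (mode0l HV); apply: primary0.
have [->|y0] := eqVneq y 0; first by rewrite (mode0r HV); apply: primary0.
have [m [abm _ pxy _]] := primary_top px py x0 y0.
by move: abm; rewrite abn => /eqP; rewrite eqr_int => /eqP e; have <- : m = n by lia.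
Qed.

Lemma primary_mode_neq0 a b x y n : primary h a x -> primary h b y -> x != 0 -> y != 0 ->
  a * b = (- n - 1)%:~R -> mode x n y != 0.
Proof.
move=> px py x0 y0 abn; have [m [abm xy _ _]] := primary_top px py x0 y0.
by move: abm; rewrite abn => /eqP; rewrite eqr_int => /eqP e; have <- : m = n by lia.
Qed.

(** The three indices are chosen at the leading exponents so that one term survives on each side of
    the Borcherds identity; x_(m + i) z = 0 for all i >= 0 removes the opposite order. *)
Lemma primary_associative a b d x y z l m n :
  primary h a x -> primary h b y -> primary h d z ->
  a * b = (- l - 1)%:~R -> b * d = (- n - 1)%:~R -> a * d = (- m)%:~R ->
  mode (mode x l y) (m + n) z = mode x (l + m) (mode y n z).
Proof.
move=> px py pz abl bdn adm; have [K0 hK0] := borcherds_fin HV x y z l m n.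
have := hK0 K0.+1 (leqnSn _); rewrite !big_ord_recl /= !big1 => [|i _|i _].
- rewrite !binz0r expr0 mulr1 !scale1r !subr0 !addr0 => ->.
  rewrite (primary_mode_eq0 (n := m - 1) px pz) ?(mode0r HV) ?scaler0 ?subr0 //.
    by rewrite adm; congr _%:~R; lia.
  by lia.
- rewrite (primary_mode_eq0 (n := n) py pz) //; last by rewrite /bump; lia.
  rewrite (primary_mode_eq0 (n := m - 1) (n' := m + (bump 0 i)%:Z) px pz).
  + by rewrite !(mode0r HV) scaler0 subr0 scaler0.
  + by rewrite adm; congr _%:~R; lia.
  + by lia.
- rewrite (primary_mode_eq0 (n := l) px py) // ?(mode0l HV) ?scaler0 //.
  by rewrite /bump; lia.
Qed.

End Heisenberg.

(** * Spans, linear extensions and multisets *)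

Section Span.
Variables (F : fieldType) (V : lmodType F).
Implicit Types (s : seq V) (u v w : V) (S : V -> Prop).

(** Generators are peeled off one at a time, without an indexed family of coefficients, to suit
    inductions on the list. *)
Fixpoint span s v : Prop :=
  if s is x :: s' then exists a : F, span s' (v - a *: x) else v = 0.

Lemma span_lin s a v w : span s v -> span s w -> span s (a *: v + w).
Proof.
elim: s v w => [|x s IHs] v w /=; first by move=> -> ->; rewrite scaler0 addr0.
move=> [b hb] [d hd]; exists (a * b + d).
by rewrite scalerDl -scalerA opprD addrACA -scalerBr; apply: IHs.
Qed.

Lemma span0 s : span s 0.
Proof. by elim: s => //= x s IHs; exists 0; rewrite scale0r subr0. Qed.

Lemma span_sum s (a : nat -> F) : span s (\sum_(i < size s) a i *: s`_i).
Proof.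
elim: s a => [|x s IHs] a; first by rewrite big_ord0.
by exists (a 0%N); rewrite big_ord_recl /= addrC addKr; apply: (IHs (fun i => a i.+1)).
Qed.

Lemma span_subspace S s v : subspace S -> (forall x, x \in s -> S x) -> span s v -> S v.
Proof.
move=> [S0 Slin]; elim: s v => [|x s IHs] v hs /=; first by move->.
case=> a ha; rewrite -[v](subrK (a *: x)) addrC; apply: Slin.
  by apply: hs; rewrite inE eqxx.
by apply: IHs => // y ys; apply: hs; rewrite inE ys orbT.
Qed.

(** [voa_finite_dim] does not place its spanning vectors in the weight space; this replaces them by
    vectors that lie in it. *)
Lemma subspace_finite_span S s : subspace S -> (forall v, S v -> span s v) ->
  exists s', (forall x, x \in s' -> S x) /\ forall v, S v -> span s' v.
Proof.
elim: s S => [|x s IHs] S Ssub hS; first by exists [::].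
have [S0 Slin] := Ssub.
have [s' [s'S hs']] : exists s', (forall x, x \in s' -> S x /\ span s x) /\
    forall v, S v /\ span s v -> span s' v.
  apply: IHs => [|v []//]; split=> [|a u v [Su su] [Sv sv]].
    by split=> //; apply: span0.
  by split; [apply: Slin|apply: span_lin].
(* A vector y of S outside the span of the tail has a nonzero coefficient d at x, so subtracting a
   multiple of y brings any vector of S into the span of the tail. *)
have [[y [Sy ys]]|nex] := pselect (exists y, S y /\ ~ span s y); last first.
  exists s'; split=> [z /s'S[]//|v Sv]; apply: hs'; split=> //.
  by apply: contrapT => vs; apply: nex; exists v.
have [d hd] := hS _ Sy.
have d0 : d != 0.
  by apply/eqP => d0; apply: ys; rewrite d0 scale0r subr0 in hd.
exists (y :: s'); split=> [z|v Sv] /=.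
  by rewrite inE => /orP[/eqP ->//|/s'S[]].
have [b hb] := hS _ Sv; exists (b / d); apply: hs'; split.
  by rewrite addrC -scaleNr; apply: Slin.
have -> : v - (b / d) *: y = (- (b / d)) *: (y - d *: x) + (v - b *: x).
  rewrite scalerBr !scalerA mulNr mulfVK // !scaleNr opprK.
  by rewrite addrACA subrr addr0 addrC.
exact: span_lin.
Qed.

End Span.

Lemma span_orthogonal (C : numClosedFieldType) (V : lmodType C) (form : V -> V -> C)
    (s : seq V) v : posdef_hermitian form ->
  exists w, span s w /\ forall x, x \in s -> form (v - w) x = 0.
Proof.
move=> Hform; have [a ha] := orthogonal_projection Hform s v.
pose b (j : nat) : C := if insub j is Some i then a i else 0.
exists (\sum_i a i *: s`_i); split=> //.
have -> : \sum_i a i *: s`_i = \sum_(i < size s) b i *: s`_i.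
  by apply: eq_bigr => i _; rewrite /b valK.
exact: span_sum.
Qed.

Section LinearExtension.
Variables (F : fieldType) (K : choiceType) (W : lmodType F).
Implicit Types (g : K -> W) (x : {malg F[K]}).

Lemma lextEw g x (D : {fset K}) : (msupp x `<=` D)%fset ->
  lext g x = \sum_(b <- D) x@_b *: g b.
Proof.
move=> xD; rewrite /lext; apply: big_fset_incl => // b _ bx.
by rewrite mcoeff_outdom // scale0r.
Qed.

Lemma lext_linear g : linear (lext g).
Proof.
move=> a x y; pose D := (msupp (a *: x + y) `|` (msupp x `|` msupp y))%fset.
rewrite !(@lextEw _ _ D); first last.
- exact: fsubsetUl.
- by apply: fsubset_trans (fsubsetUr _ _); apply: fsubsetUl.
- by apply: fsubset_trans (fsubsetUr _ _); apply: fsubsetUr.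
rewrite scaler_sumr -big_split; apply: eq_bigr => b _ /=.
by rewrite mcoeffD mcoeffZ scalerDl scalerA.
Qed.

Lemma lext_basis g b : lext g << b >> = g b.
Proof.
by rewrite (@lextEw _ _ [fset b]%fset) ?msuppU_le // big_seq_fset1 mcoeffUU scale1r.
Qed.

Lemma eq_lext g g' : g =1 g' -> lext g =1 lext g'.
Proof. by move=> gg' x; apply: eq_bigr => b _; rewrite gg'. Qed.

Lemma lin_lext (W' : lmodType F) (f : W -> W') g x :
  linear f -> f (lext g x) = lext (f \o g) x.
Proof.
by move=> fL; rewrite /lext (lin_sum fL); apply: eq_bigr => b _; rewrite (linZ fL).
Qed.

End LinearExtension.

Section LinearMalg.
Variables (F : fieldType) (K : choiceType) (W : lmodType F).

Lemma lext_id (x : {malg F[K]}) : lext (fun b => << b >>) x = x.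
Proof.
rewrite [RHS]monalgE /lext; apply: eq_bigr => b _.
by apply/malgP => b'; rewrite mcoeffZ !mcoeffU mulr_natr.
Qed.

Lemma linear_lext (f : {malg F[K]} -> W) : linear f -> f =1 lext (fun b => f << b >>).
Proof. by move=> fL x; rewrite -[in LHS](lext_id x) (lin_lext _ _ fL). Qed.

Lemma eq_linear (f f' : {malg F[K]} -> W) : linear f -> linear f' ->
  (forall b, f << b >> = f' << b >>) -> f =1 f'.
Proof. by move=> fL fL' e x; rewrite (linear_lext fL) (linear_lext fL'); apply: eq_lext. Qed.

End LinearMalg.

Section Multisets.
Local Open Scope mset_scope.
Implicit Types (s t : {mset nat}).

Lemma seq_mset_cons i r : seq_mset (i :: r) = i +` seq_mset r :> {mset nat}.
Proof. by apply/msetP => j; rewrite mset_seqE mset1DE mset_seqE /= eq_sym. Qed.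

Lemma mset_ind (P : {mset nat} -> Prop) :
  P mset0 -> (forall i s, P s -> P (i +` s)) -> forall s, P s.
Proof.
move=> P0 PS s; rewrite -(seq_mset_id s); elim: (s : seq nat) => [|i r IHr].
  suff -> : seq_mset [::] = mset0 :> {mset nat} by [].
  by apply/msetP => j; rewrite mset_seqE mset0E.
by rewrite seq_mset_cons; apply: PS.
Qed.

Lemma perm_enum_mset1D i s : perm_eq (enum_mset (i +` s)) (i :: enum_mset s).
Proof.
rewrite -[i +` s](_ : seq_mset (i :: s) = _) ?perm_eq_seq_mset //.
by rewrite seq_mset_cons seq_mset_id.
Qed.

Lemma mset1DB i j s : (i != j) || (0 < s i)%N -> (j +` s) `\ i = j +` (s `\ i).
Proof.
move=> ij; apply/msetP => a; rewrite msetB1E !mset1DE msetB1E.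
by have [->|] := eqVneq a i; [case: eqVneq ij => //= _|]; lia.
Qed.

End Multisets.

Lemma foldr_perm (T : eqType) (W : Type) (f : T -> W -> W) (x : W) (s t : seq T) :
  (forall i j w, f i (f j w) = f j (f i w)) -> perm_eq s t -> foldr f x s = foldr f x t.
Proof.
move=> fC st; pose P r := foldr f x s = foldr f x r; rewrite -/(P t).
have fcat r r' w : foldr f (foldr f w r) r' = foldr f (foldr f w r') r.
  elim: r => //= i r <-; elim: r' => //= j r' ->; exact: fC.
by apply: (catCA_perm_ind _ st) => // r1 r2 r3; rewrite /P !foldr_cat fcat.
Qed.

(** * Completeness of the Fock vectors *)

Section Completeness.
Variables (C : numClosedFieldType) (V : vertexData C) (phi : V -> V) (form : V -> V -> C).
Variable h : V.
Hypothesis HD : unitary_heisenberg phi form h.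
Implicit Types (u v w x y z : V) (a b : C).

Let HV := uh_voa HD.
Let HC := uh_cft HD.
Let Hform := uh_form HD.

Lemma homogeneous_span (n : int) : exists s : seq V,
  (forall x, x \in s -> homogeneous n x) /\ forall v, homogeneous n v -> span s v.
Proof.
have [s hs] := voa_finite_dim HV n; apply: (@subspace_finite_span _ _ (homogeneous n) s).
  by split; [apply: (homogeneous0 HV)|apply: (homogeneous_lin HV)].
move=> v /hs[a ->]; pose b (j : nat) : C := if insub j is Some i then a i else 0.
have -> : \sum_i a i *: s`_i = \sum_(i < size s) b i *: s`_i.
  by apply: eq_bigr => i _; rewrite /b valK.
exact: span_sum.
Qed.

Lemma heis_vir0 x : (forall n : int, 0 < n -> mode h n x = 0) ->
  mode h 0 (mode h 0 x) = 2%:R *: vir 0 x.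
Proof.
move=> hx; rewrite /vir (conf_mode HD) (@associator _ _ _ HV h h x 0 1 1).
- rewrite big_ord1 bin0 expr0 !scale1r (hx 1) // (mode0r HV) add0r scalerA.
  by rewrite divff ?pnatr_eq0 // scale1r.
- by move=> i i1; apply: hx; lia.
- by move=> i i1; apply: hx; lia.
Qed.

Variable W : V -> Prop.
Hypotheses (Wsub : subspace W) (Wprim : forall a x, primary h a x -> W x).
Hypothesis Wheis : forall (m : nat) x, W x -> W (mode h (- m%:Z - 1) x).

(** On u one has h_0^2 = 2 p. For p > 0 this splits u into eigenvectors of h_0 for the two square
    roots of 2 p; for p = 0, u is a multiple of the vacuum. *)
Lemma vacuum_vectors (p : nat) u : homogeneous p u ->
  (forall n : int, 0 < n -> mode h n u = 0) -> W u.
Proof.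
have [W0 Wlin] := Wsub; move=> hu hn; have := heis_vir0 hn; rewrite hu scalerA => e.
case: p hu e => [|p] hu e.
  by have [b ->] := (HC.2 _).1 hu; apply: (Wprim (a := 0)); apply: (primaryZ HD _ (primary_vac HD)).
pose s : C := sqrtC (2 * p.+1)%:R.
have ss : s * s = 2%:R * (Posz p.+1)%:~R by rewrite -expr2 sqrtCK natrM.
have s0 : s != 0 by rewrite sqrtC_eq0 pnatr_eq0.
have pp (t : C) : t * t = s * s -> primary h t (mode h 0 u + t *: u).
  move=> tt; split=> [n n0|].
    have := heis_commutator HD n 0 u; rewrite addr0 (gt_eqF n0) (hn n n0) (mode0r HV) subr0.
    by move=> e1; rewrite (modeDr HV) (modeZr HV) e1 (hn n n0) scaler0 addr0.
  by rewrite (modeDr HV) (modeZr HV) e -ss -tt scalerDr scalerA addrC.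
have Wp := Wprim (pp s erefl); have Wm := Wprim (pp (- s) (mulrNN _ _)).
have -> : u = (2%:R * s)^-1 *: ((mode h 0 u + s *: u) + (-1) *: (mode h 0 u + (- s) *: u)).
  rewrite scaleN1r scaleNr opprD opprK addrACA subrr add0r -scalerDl scalerA.
  by rewrite -mulr2n -[s *+ 2]mulr_natl mulVf ?scale1r // mulf_neq0 // pnatr_eq0.
rewrite -[_ *: _]addr0; apply: (Wlin) => //.
by rewrite addrC; apply: Wlin.
Qed.

(** Completeness takes the form of an induction principle for [W]. By induction on the weight, [W]
    contains the list [L] of the h_(- m - 1) y, and the part of x orthogonal to [L] is a vacuum
    vector. *)
Lemma heisenberg_complete v : W v.
Proof.
have [W0 Wlin] := Wsub.
have WD x y : W x -> W y -> W (x + y) by move=> Wx Wy; rewrite -[x]scale1r; apply: Wlin.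
have [s [hs ->]] := voa_graded HV v; elim: s hs => [|x s IHs] hs; first by rewrite big_nil.
rewrite big_cons; apply: (WD); last by apply: IHs => z zs; apply: hs; rewrite inE zs orbT.
have [n hx] : exists n, homogeneous n x by apply: hs; rewrite inE eqxx.
have [n0|] := ltP n 0; first by rewrite (HC.1 _ _ n0 hx).
case: n hx => // n hx _; elim/ltn_ind: n x hx {s IHs hs} => n IHn x hx.
have [B hB] := choice homogeneous_span.
pose L := flatten [seq [seq mode h (- m%:Z - 1) y | y <- B (n%:Z - m%:Z - 1)] | m <- iota 0 n].
have inL z : z \in L -> W z /\ homogeneous n z.
  move=> /flattenP[r /mapP[m mn ->]] /mapP[y yB ->].
  have hy := (hB _).1 _ yB; rewrite mem_iota /= add0n in mn; split.
    apply: Wheis; apply: (IHn (n - m.+1)%N); first by lia.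
    by move: hy; congr (homogeneous _ _); lia.
  by have := homogeneous_mode HV (- m%:Z - 1) (uh_weight HD) hy; congr (homogeneous _ _); lia.
have [w [Lw hw]] := span_orthogonal L x Hform.
have Ww : W w by apply: (span_subspace Wsub _ Lw) => z /inL[].
have homw : homogeneous n w.
  apply: (span_subspace _ _ Lw) => [|z /inL[]//].
  by split; [apply: (homogeneous0 HV)|apply: (homogeneous_lin HV)].
rewrite -(subrK w x); apply: (WD) => //.
have hu := homogeneousB HV hx homw; set u := x - w in hu hw *.
apply: (vacuum_vectors hu) => -[[//|m]|//] _.
have ht := homogeneous_mode HV m.+1 (uh_weight HD) hu.
have [nm|mn] := leqP n m; first by apply: (HC.1 _ _ _ ht); lia.
(* The vector h_(m + 1) u lies in the span of the weight space's generators y, and (h_(m + 1) u, y)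
   = (u, h_(- m - 1) y) = 0; hence it is orthogonal to itself. *)
apply: (form_eq0 Hform); pose S y := form (mode h m.+1 u) y = 0; apply: (_ : S _).
have htB : span (B (n%:Z - m%:Z - 1)) (mode h m.+1 u).
  by apply: (hB _).2; move: ht; congr (homogeneous _ _); lia.
apply: (span_subspace _ _ htB) => [|y yB].
  split=> [|a y z Sy Sz]; first exact: (form0r Hform).
  by rewrite /S (formDr Hform) (formZr Hform) Sy Sz mulr0 addr0.
rewrite /S (heis_adjoint HD); apply: hw; apply/flattenP.
exists [seq mode h (- m%:Z - 1) y | y <- B (n%:Z - m%:Z - 1)].
  by apply/mapP; exists m; rewrite ?mem_iota.
by apply/mapP; exists y => //; congr (mode _ _ _); lia.
Qed.

End Completeness.

(** * Fock vectors and the comparison map *)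

Section FockBasis.
Variables (C : numClosedFieldType) (V : vertexData C) (phi : V -> V) (form : V -> V -> C).
Variable h : V.
Hypothesis HD : unitary_heisenberg phi form h.
Variable q : C.
Implicit Types (u v w : V) (s t : {mset nat}%mset).

Let HV := uh_voa HD.
Let HC := uh_cft HD.
Let Hform := uh_form HD.

(** The vector q h plays the role of gamma in the models, with (gamma, gamma) = q^2. *)
Definition current (n : int) (w : V) : V := mode (q *: h) n w.

Lemma currentE n w : current n w = q *: mode h n w.
Proof. by rewrite /current (modeZl HV). Qed.

Lemma current_linear n : linear (current n).
Proof. exact: (va_linr HV). Qed.

Lemma current_commutator m n w :
  current m (current n w) - current n (current m w) =
  if m + n == 0 then (q ^+ 2 * m%:~R) *: w else 0.
Proof.
rewrite !currentE !(modeZr HV) !scalerA -scalerBr (heis_commutator HD).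
by case: ifP; rewrite ?scaler0 // scalerA expr2.
Qed.

Definition fock_vector x s : V := foldr (fun i w => current (- i%:Z - 1) w) x (enum_mset s).

Lemma fock_vector0 x : fock_vector x mset0 = x.
Proof. by rewrite /fock_vector enum_mset0. Qed.

Lemma fock_vector1D x i s :
  fock_vector x (i +` s)%mset = current (- i%:Z - 1) (fock_vector x s).
Proof.
rewrite /fock_vector (@foldr_perm _ _ _ _ _ (i :: enum_mset s)) //.
  move=> j k w; apply/eqP; rewrite -subr_eq0 current_commutator.
  by case: ifP => // /eqP; lia.
exact: perm_enum_mset1D.
Qed.

Lemma current0_fock a x s : primary h a x ->
  current 0 (fock_vector x s) = (q * a) *: fock_vector x s.
Proof.
move=> [_ h0x]; elim/mset_ind: s => [|i s IHs].
  by rewrite fock_vector0 currentE h0x scalerA.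
rewrite fock_vector1D; have := current_commutator 0 (- i%:Z - 1) (fock_vector x s).
case: ifP => [/eqP|_ /eqP]; first by lia.
by rewrite subr_eq0 IHs (linZ (current_linear _)) => /eqP.
Qed.

Lemma currentS_fock a x s (i : nat) : primary h a x ->
  current i.+1 (fock_vector x s) =
  (q ^+ 2 * i.+1%:R * (s i)%:R) *: fock_vector x (s `\ i)%mset.
Proof.
move=> [hx _]; elim/mset_ind: s => [|j s IHs].
  by rewrite fock_vector0 currentE hx // mset0E mulr0 scale0r scaler0.
rewrite fock_vector1D mset1DE.
have := current_commutator i.+1 (- j%:Z - 1) (fock_vector x s).
move/eqP; rewrite subr_eq => /eqP ->; rewrite IHs (linZ (current_linear _)).
have -> : (i.+1%:Z + (- j%:Z - 1) == 0) = (i == j) by lia.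
have [<-|ij] := eqVneq i j; last first.
  by rewrite add0r mset1DB ?ij // fock_vector1D.
(* Putting i back into s with i removed gives s only if i occurs in s; if it does not, the
   coefficient is 0. *)
rewrite msetD1K; case: (posnP (s i)) => [->|si].
  by rewrite mulr0 scale0r addr0 mulr1.
rewrite -fock_vector1D -mset1DB ?si ?orbT // msetD1K -scalerDl natrD.
by congr (_ *: _); rewrite mulrDr mulr1.
Qed.

Hypothesis q0 : q != 0.

(** As q need not be real, adjointness holds up to the factor q / q^*, which is harmless for
    orthogonality. *)
Lemma current_adjoint : exists2 a, a != 0 &
  forall n u v, form (current n u) v = a * form u (current (- n) v).
Proof.
have qC : q^* != 0 by rewrite fmorph_eq0.
exists (q / q^*) => [|n u v]; first by rewrite mulf_neq0 // invr_eq0.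
by rewrite !currentE (formZl Hform) (formZr Hform) (heis_adjoint HD) mulrA mulfVK.
Qed.

(** The mode i + 1 of the current turns the vector of i + s into a nonzero multiple of that of s. *)
Lemma fock_vector_neq0 a x s : primary h a x -> x != 0 -> fock_vector x s != 0.
Proof.
move=> px x0; elim/mset_ind: s => [|i s IHs]; first by rewrite fock_vector0.
apply: contra IHs => /eqP e; have := currentS_fock (i +` s)%mset i px.
rewrite e (lin0 (current_linear _)) msetD1K => /esym/eqP.
by rewrite scaler_eq0 mset1DE eqxx !mulf_eq0 (negPf q0) !pnatr_eq0 /=.
Qed.

(** Each creation operator on the left moves to the right as an annihilator, where it removes the
    same factor from t or gives 0. *)
Lemma fock_vector_orthogonal a b x y s t : primary h a x -> primary h b y ->
  (s != t) || (form x y == 0) -> form (fock_vector x s) (fock_vector y t) = 0.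
Proof.
move=> px py; have [d d0 hd] := current_adjoint.
elim/mset_ind: s t => [|i s IHs] t.
  elim/mset_ind: t => [|j t _ _]; first by rewrite eqxx !fock_vector0 => /eqP.
  rewrite fock_vector0 fock_vector1D (formC Hform) hd.
  have -> : - (- j%:Z - 1) = j.+1 by lia.
  by rewrite currentE px.1 // scaler0 (form0r Hform) mulr0 rmorph0.
rewrite fock_vector1D hd => st.
have -> : - (- i%:Z - 1) = i.+1 by lia.
rewrite (currentS_fock _ _ py) (formZr Hform).
have [ti0|ti] := posnP (t i); first by rewrite ti0 mulr0 rmorph0 mul0r mulr0.
rewrite IHs ?mulr0 //; apply: contraTT st; rewrite !negb_or !negbK => /andP[/eqP e ->].
by rewrite e msetB1K ?eqxx // in_mset.
Qed.

Lemma form_primary a b x y : primary h a x -> primary h b y -> a != b -> form x y = 0.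
Proof.
move=> px py ab; have [->|y0] := eqVneq y 0; first exact: (form0r Hform).
have /CrealP bR := primary_real HD py y0.
have := heis_adjoint HD 0 x y; rewrite oppr0 px.2 py.2 (formZl Hform) (formZr Hform) bR.
by move/eqP; rewrite -subr_eq0 -mulrBl mulf_eq0 subr_eq0 (negPf ab) => /eqP.
Qed.

Section Basis.
Variables (I : eqType) (K : choiceType) (ch : I -> C) (E : I -> V) (p : K -> {mset nat}%mset * I).
Hypotheses (Eprim : forall i, primary h (ch i) (E i)) (E0 : forall i, E i != 0).
Hypotheses (ch_inj : injective ch) (p_inj : injective p).

(** The index type I of charges and the basis type K of the model are left abstract so that one map
    serves both models. *)
Definition fock_map : {malg C[K]} -> V := lext (fun b : K => fock_vector (E (p b).2) (p b).1).

Lemma fock_map_linear : linear fock_map.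
Proof. exact: lext_linear. Qed.

Lemma fock_map_basis (b : K) : fock_map << b >> = fock_vector (E (p b).2) (p b).1.
Proof. exact: lext_basis. Qed.

(** Pairing the image of x with that of a basis element b isolates the coefficient of b in x times a
    positive norm. *)
Lemma fock_map_inj : injective fock_map.
Proof.
suff ker0 (x : {malg C[K]}) : fock_map x = 0 -> x = 0.
  move=> x y e; apply/eqP; rewrite -subr_eq0; apply/eqP/ker0.
  by rewrite (linB fock_map_linear) e subrr.
move=> gx0; apply/malgP => b; rewrite mcoeff0; apply/eqP; rewrite mcoeff_eq0.
apply/negP => bx; have := congr1 (form^~ (fock_map << b >>)) gx0.
rewrite (form0l Hform) {1}/fock_map /lext (form_suml Hform) (big_fsetD1 b) //= big_seq big1.
  rewrite addr0 (formZl Hform) -fock_map_basis => /eqP.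
  rewrite mulf_eq0 mcoeff_eq0 bx /= gt_eqF // (form_gt0 Hform) // fock_map_basis.
  exact: fock_vector_neq0.
move=> b'; rewrite in_fsetD1 => /andP[b'b _].
rewrite (formZl Hform) fock_map_basis.
rewrite (@fock_vector_orthogonal (ch (p b').2) (ch (p b).2)) ?mulr0 //.
have [e1 /=|//] := eqVneq (p b').1 (p b).1; apply/eqP/form_primary; first exact: Eprim.
  exact: Eprim.
apply: contra b'b => /eqP/ch_inj e2; apply/eqP/p_inj.
by rewrite [p b']surjective_pairing [p b]surjective_pairing e1 e2.
Qed.

Lemma fock_map_surj : (forall s i, exists b : K, p b = (s, i)) ->
  (forall a x, primary h a x -> exists i b, x = b *: E i) -> forall v, exists x, fock_map x = v.
Proof.
move=> p_surj hE; apply: (heisenberg_complete HD).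
- split=> [|a u v [x <-] [y <-]]; first by exists 0; apply: (lin0 fock_map_linear).
  by exists (a *: x + y); apply: fock_map_linear.
- move=> a x /hE[i [b ->]]; have [k hk] := p_surj mset0 i.
  by exists (b *: << k >>); rewrite (linZ fock_map_linear) fock_map_basis hk fock_vector0.
- move=> m _ [x <-].
  have /choice[k hk] (b : K) : exists b', p b' = ((m +` (p b).1)%mset, (p b).2).
    exact: p_surj.
  exists (q^-1 *: lext (fun b : K => << k b >>) x).
  rewrite (linZ fock_map_linear) (lin_lext _ _ fock_map_linear).
  apply: (scalerI q0); rewrite scalerA divff // scale1r -currentE.
  rewrite [in RHS]/fock_map (lin_lext _ _ (current_linear _)); apply: eq_lext => b /=.
  by rewrite fock_map_basis hk fock_vector1D.
Qed.

End Basis.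
End FockBasis.

(** * Exponentials and normally ordered products *)

Section ExpCoef.
Variables (F : numFieldType) (W : lmodType F) (A : nat -> W -> W).
Hypothesis AL : forall n, linear (A n).
Implicit Types (w : W) (n m r j : nat).

Lemma pow_coef_linear j r : linear (pow_coef A j r).
Proof.
elim: j r => [|j IHj] r a u v /=; first by case: ifP => // _; rewrite scaler0 addr0.
rewrite scaler_sumr -big_split; apply: eq_bigr => n _ /=.
by rewrite IHj AL.
Qed.

Lemma exp_coef_linear r : linear (exp_coef A r).
Proof.
move=> a u v; rewrite /exp_coef scaler_sumr -big_split; apply: eq_bigr => j _ /=.
by rewrite pow_coef_linear scalerDr !scalerA mulrC.
Qed.

Lemma pow_coef_eq0 j r w : (r < j)%N -> pow_coef A j r w = 0.
Proof.
elim: j r => // j IHj r rj; rewrite /= big_nat big1 // => n /andP[n1 nr].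
by rewrite IHj ?(lin0 (AL n)) //; lia.
Qed.

Lemma exp_coef0 w : exp_coef A 0 w = w.
Proof. by rewrite /exp_coef big_nat1 /= invr1 scale1r. Qed.

Hypothesis AC : forall n m w, (0 < n)%N -> (0 < m)%N -> A n (A m w) = A m (A n w).

(** Both sides run over the pairs n, m >= 1 with n + m <= r. *)
Lemma triangle_exchange (f : nat -> nat -> W) r :
  \sum_(1 <= n < r.+1) \sum_(1 <= m < (r - n).+1) f n m =
  \sum_(1 <= m < r.+1) \sum_(1 <= n < (r - m).+1) f n m.
Proof.
have widen (g : nat -> W) n : (n <= r)%N -> \sum_(1 <= m < (r - n).+1) g m =
    \sum_(1 <= m < r.+1) if (n + m <= r)%N then g m else 0.
  move=> nr; rewrite (big_nat_widen _ _ r.+1) ?ltnS ?leq_subr //= big_mkcond.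
  by apply: eq_bigr => m _; have -> : (m < (r - n).+1)%N = (n + m <= r)%N by lia.
transitivity (\sum_(1 <= n < r.+1) \sum_(1 <= m < r.+1) if (n + m <= r)%N then f n m else 0).
  by rewrite !big_nat; apply: eq_bigr => n /andP[_ nr]; rewrite widen.
rewrite exchange_big_nat /= !big_nat; apply: eq_bigr => m /andP[_ mr].
by rewrite widen //; apply: eq_bigr => n _; rewrite addnC.
Qed.

(** Coefficientwise, z (d/dz) f^(j + 1) = (j + 1) (z f') f^j. Writing r = n + (r - n) is the product
    rule for the first factor and the rest. *)
Lemma pow_coef_rec j r w : r%:R *: pow_coef A j.+1 r w =
  j.+1%:R *: \sum_(1 <= n < r.+1) n%:R *: A n (pow_coef A j (r - n) w).
Proof.
elim: j r => [|j IHj] r.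
  rewrite scale1r /= scaler_sumr !big_nat; apply: eq_bigr => n /andP[_ nr].
  by case: eqP => [rn|_]; [congr (_%:R *: _); lia|rewrite (lin0 (AL n)) !scaler0].
transitivity (\sum_(1 <= n < r.+1) n%:R *: A n (pow_coef A j.+1 (r - n) w) +
  \sum_(1 <= n < r.+1) \sum_(1 <= m < (r - n).+1)
     (j.+1%:R * m%:R) *: A n (A m (pow_coef A j (r - n - m) w))).
  rewrite [pow_coef A j.+2 r w]/= scaler_sumr -big_split !big_nat.
  apply: eq_bigr => n /andP[_ nr] /=.
  rewrite -{1}(subnKC (_ : n <= r)%N) // natrD scalerDl; congr (_ + _).
  rewrite -(linZ (AL n)) IHj (linZ (AL n)) (lin_sum (AL n)) scaler_sumr.
  by apply: eq_bigr => m _; rewrite (linZ (AL n)) scalerA.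
rewrite triangle_exchange [RHS]scaler_sumr -big_split !big_nat; apply: eq_bigr => n /andP[n0 nr] /=.
rewrite -[in RHS]natr1 scalerDl addrC scale1r; congr (_ + _).
rewrite scalerA (lin_sum (AL n)) scaler_sumr !big_nat; apply: eq_bigr => m /andP[m0 mr].
by rewrite AC // subnAC.
Qed.

(* The equation z (d/dz) exp(f) = (z f') exp(f), coefficientwise. *)
Lemma exp_coef_rec r w : r%:R *: exp_coef A r w =
  \sum_(1 <= n < r.+1) n%:R *: A n (exp_coef A (r - n) w).
Proof.
rewrite /exp_coef big_nat_recl //= scalerDr.
have -> : r%:R *: ((0`!)%:R^-1 *: (if r == 0%N then w else 0)) = 0 :> W.
  by case: eqP => [->|_]; rewrite ?scale0r // !scaler0.
rewrite add0r scaler_sumr.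
transitivity (\sum_(0 <= j < r) \sum_(1 <= n < r.+1)
    (j`!)%:R^-1 *: (n%:R *: A n (pow_coef A j (r - n) w))).
  apply: eq_bigr => j _; rewrite scalerA mulrC -scalerA pow_coef_rec scalerA.
  rewrite factS natrM invfM mulrAC mulVf ?pnatr_eq0 // mul1r.
  by rewrite scaler_sumr.
rewrite exchange_big_nat /= !big_nat; apply: eq_bigr => n /andP[n0 nr].
(* The exponential on the right stops at the power r - n; the powers added by widening have zero
   coefficient. *)
rewrite (lin_sum (AL n)) scaler_sumr [RHS](big_nat_widen _ _ r) /=; last by lia.
rewrite [RHS]big_mkcond big_nat [RHS]big_nat; apply: eq_bigr => j _.
rewrite (linZ (AL n)) scalerA mulrC -scalerA; case: ltnP => // rj.
by rewrite pow_coef_eq0 // (lin0 (AL n)) !scaler0.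
Qed.

(** For r > 0 the integer r is invertible, so the recursion determines f r from the earlier
    coefficients. *)
Lemma exp_coef_unique (f : nat -> W) :
  (forall r, r%:R *: f r = \sum_(1 <= n < r.+1) n%:R *: A n (f (r - n)%N)) ->
  forall r, f r = exp_coef A r (f 0%N).
Proof.
move=> hf; elim/ltn_ind => -[_|r IHr]; first by rewrite exp_coef0.
apply: (@scalerI _ _ r.+1%:R); first by rewrite pnatr_eq0.
rewrite hf exp_coef_rec !big_nat; apply: eq_bigr => n /andP[n0 nr].
by rewrite IHr //; lia.
Qed.

(** With A the series of the A_n, this is exp(A) D = D exp(A) + c z^m exp(A). The right side
    satisfies the recursion of the exponential with initial value D w, so uniqueness applies. *)
Lemma exp_coef_commutator (D : W -> W) m c w : linear D -> (0 < m)%N ->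
  (forall n w, (0 < n)%N -> A n (D w) = D (A n w) + (if n == m then c *: w else 0)) ->
  forall r, exp_coef A r (D w) =
    D (exp_coef A r w) + (if (m <= r)%N then c *: exp_coef A (r - m) w else 0).
Proof.
move=> DL m0 AD r.
pose f r := D (exp_coef A r w) + (if (m <= r)%N then c *: exp_coef A (r - m) w else 0).
have f0 : f 0%N = D w by rewrite /f exp_coef0 leqNgt m0 addr0.
rewrite -/(f r) -f0; apply/esym/exp_coef_unique => {}r.
rewrite {1}/f scalerDr -(linZ DL) exp_coef_rec (lin_sum DL).
have E n : (0 < n <= r)%N -> n%:R *: A n (f (r - n)%N) =
    D (n%:R *: A n (exp_coef A (r - n) w)) +
    ((if n == m then (n%:R * c) *: exp_coef A (r - m) w else 0) +
     (if (n <= r - m)%N && (m <= r)%N then c *: (n%:R *: A n (exp_coef A (r - m - n) w)) else 0)).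
  move=> /andP[n0 nr]; rewrite /f (linD (AL n)) AD // !scalerDr (linZ DL) addrA.
  congr (_ + _ + _).
    by case: eqP => [->|_]; rewrite ?scaler0 // scalerA.
  have -> : (n <= r - m)%N && (m <= r)%N = (m <= r - n)%N by lia.
  case: ifP => _; last by rewrite (lin0 (AL n)) scaler0.
  by rewrite (linZ (AL n)) !scalerA mulrC subnAC.
have -> : \sum_(1 <= n < r.+1) n%:R *: A n (f (r - n)%N) =
  \sum_(1 <= n < r.+1) (D (n%:R *: A n (exp_coef A (r - n) w)) +
    ((if n == m then (n%:R * c) *: exp_coef A (r - m) w else 0) +
     (if (n <= r - m)%N && (m <= r)%N then c *: (n%:R *: A n (exp_coef A (r - m - n) w)) else 0))).
  by rewrite !big_nat; apply: eq_bigr => n /andP[n0 nr]; rewrite E // n0.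
rewrite big_split; congr (_ + _); rewrite big_split /=.
have [mr|rm] := leqP m r; last first.
  rewrite scaler0 big_nat big1 ?add0r ?big1 // => [n _|n /andP[_ nr]]; first by rewrite andbF.
  by case: eqP => // nm; lia.
rewrite -big_mkcond /= big_nat1_eq m0 ltnS mr /=.
have -> : \sum_(1 <= n < r.+1) (if (n <= r - m)%N && true
      then c *: (n%:R *: A n (exp_coef A (r - m - n) w)) else 0) =
    c *: ((r - m)%:R *: exp_coef A (r - m) w).
  rewrite exp_coef_rec scaler_sumr [RHS](big_nat_widen _ _ r.+1) ?ltnS ?leq_subr //=.
  by rewrite [RHS]big_mkcond; apply: eq_bigr => n _; rewrite andbT ltnS.
(* The factor m c of the new term and (r - m) c of the recursion add up to r c. *)
by rewrite !scalerA -scalerDl; congr (_ *: _); rewrite natrB //; ring.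
Qed.

End ExpCoef.

Lemma exp_coef_intertwine (F : fieldType) (W W' : lmodType F) (g : W -> W')
    (A : nat -> W -> W) (A' : nat -> W' -> W') : linear g ->
  (forall n w, (0 < n)%N -> g (A n w) = A' n (g w)) ->
  forall r w, g (exp_coef A r w) = exp_coef A' r (g w).
Proof.
move=> gL gA r w; rewrite /exp_coef (lin_sum gL); apply: eq_bigr => j _.
rewrite (linZ gL); congr (_ *: _); elim: j r => [|j IHj] r /=.
  by case: ifP => // _; rewrite (lin0 gL).
rewrite (lin_sum gL) !big_nat; apply: eq_bigr => n /andP[n0 _].
by rewrite gA // IHj.
Qed.

(** * Normally ordered products *)

Section NormalProduct.

Lemma fsum_nonneg (W : zmodType) (f : int -> W) K : (forall i : nat, (K <= i)%N -> f i%:Z = 0) ->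
  \sum_(m \in [set m : int | 0 <= m]) f m = \sum_(i < K) f i%:Z.
Proof.
move=> f0; rewrite (@reindex_fsbig _ _ _ _ _ Posz setT) ?(fsum_nat f0) //.
split=> [i _ //|i j _ _ [->] //|[m|m] //= _]; by exists m.
Qed.

Lemma fsum_neg (W : zmodType) (f : int -> W) K :
  (forall i : nat, (K <= i)%N -> f (- i%:Z - 1) = 0) ->
  \sum_(m \in [set m : int | m < 0]) f m = \sum_(i < K) f (- i%:Z - 1).
Proof.
move=> f0; rewrite (@reindex_fsbig _ _ _ _ _ (fun i : nat => - i%:Z - 1) setT).
  exact: fsum_nat.
split=> [i _ /=|i j _ _ /=|m /= m0]; [lia|lia|].
by exists (absz (m + 1)) => //; lia.
Qed.

Lemma normal_product_intertwine (F : fieldType) (W W' : lmodType F) (g : W -> W')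
    (G Y : int -> W -> W) (G' Y' : int -> W' -> W') p n w :
  linear g -> injective g -> (forall n w, g (G n w) = G' n (g w)) ->
  (forall n w, g (Y n w) = Y' n (g w)) ->
  g (normal_product G p Y n w) = normal_product G' p Y' n (g w).
Proof.
move=> gL g_inj gG gY; rewrite /normal_product (linD gL) !(lin_fsum gL) //.
by congr (_ + _); apply: eq_fsbigr => m _; rewrite (linZ gL) ?gG ?gY ?gG.
Qed.

Variables (C : numClosedFieldType) (V : vertexData C) (c : C).
Hypothesis HV : is_VOA V c.
Implicit Types u v : V.

Lemma mode_normal_product u v (p : nat) n w :
  mode (mode u (- p%:Z - 1) v) n w = normal_product (mode u) p (mode v) n w.
Proof.
have [K1 h1] := mode_trunc HV v w n; have [K2 h2] := mode_trunc HV u w 0.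
pose K := maxn K1 K2; have hv i : (K <= i)%N -> mode v (n + i%:Z) w = 0.
  by rewrite /K geq_max => /andP[/h1].
have hu i : (K <= i)%N -> mode u i%:Z w = 0.
  by rewrite /K geq_max => /andP[_ /h2]; rewrite add0r.
rewrite (associator HV _ hv hu) /normal_product.
(* The first p terms carry the binomials of i over p with i < p, which vanish; the shift by p
   accounts for the bound p + K. *)
rewrite (fsum_neg (K := p + K)) => [|i Ki]; last first.
  have -> : n - (- i%:Z - 1) - p%:Z - 1 = n + (i - p)%N%:Z by lia.
  by rewrite hv ?(mode0r HV) ?scaler0 //; lia.
rewrite (fsum_nonneg (K := K)) => [|i Ki]; last first.
  by rewrite hu // (mode0r HV) scaler0.
rewrite big_split_ord /= [X in _ = X + _ + _]big1 => [|i _]; last first.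
  have -> : - (- i%:Z - 1) - 1 = i%:Z by lia.
  by rewrite binz_nat bin_small // scale0r.
rewrite add0r -big_split; apply: eq_bigr => i _ /=; rewrite scalerDr; congr (_ + _).
  have -> : - (- (p + i)%N%:Z - 1) - 1 = (p + i)%N by lia.
  rewrite binz_nat; congr (_ *: mode _ _ (mode _ _ _)); lia.
rewrite binzN -[in RHS]addnC scalerA mulrC; congr (_ *: mode _ _ _); lia.
Qed.

Lemma mode_intertwine (W : lmodType C) (g : W -> V) (G Y : int -> W -> W) u x (r : seq nat) n w :
  linear g -> injective g -> (forall n w, g (G n w) = mode u n (g w)) ->
  (forall n w, g (Y n w) = mode x n (g w)) ->
  g (foldr (normal_product G) Y r n w) =
  mode (foldr (fun (i : nat) => mode u (- i%:Z - 1)) x r) n (g w).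
Proof.
move=> gL g_inj gG gY; elim: r n w => //= i r IHr n w.
by rewrite mode_normal_product; apply: normal_product_intertwine.
Qed.

End NormalProduct.

(** The comparison maps go from the model to V, while [VOA_iso] asks for a map out of V. *)
Lemma VOA_iso_inverse (F : fieldType) (V W : vertexData F) (g : W -> V) :
  linear g -> injective g -> (forall v, exists w, g w = v) ->
  g vac = vac -> g conf = conf ->
  (forall u v n, g (mode u n v) = mode (g u) n (g v)) -> VOA_iso V W.
Proof.
move=> gL g_inj /choice[f gf] gvac gconf gmode.
have fg : cancel g f by move=> w; apply: g_inj; rewrite gf.
exists f; split=> [a u v||||u v n].
- by apply: g_inj; rewrite gL !gf.
- by exists g.
- by rewrite -gvac fg.
- by rewrite -gconf fg.
- by rewrite -{1}(gf u) -{1}(gf v) -gmode fg.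
Qed.

(** * Vertex operators of charged vectors *)

Section VertexOperator.
Variables (C : numClosedFieldType) (V : vertexData C) (phi : V -> V) (form : V -> V -> C).
Variable h : V.
Hypothesis HD : unitary_heisenberg phi form h.
Variables (q a b : C) (t : int) (x y : V).
Hypotheses (px : primary h (q * a) x) (py : primary h b y).
Hypothesis ab : q * a * b = t%:~R.
Implicit Types (s : {mset nat}%mset) (m r : nat) (j : int).

Let HV := uh_voa HD.
Local Notation cur := (current h q).
(** With gamma = q h, [Am] and [Ap] are the exponents of the two exponential factors of Y(e^a, z),
    for x of charge q a. *)
Let Am n (w : V) := (a / n%:R) *: cur (- n%:Z) w.
Let Ap n (w : V) := - (a / n%:R) *: cur n%:Z w.
Let z : V := mode x (- t - 1) y.
(** An integer index, with value 0 at negative ones, spares case distinctions on the mode n. *)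
Let em (j : int) (w : V) : V := if j is Posz r then exp_coef Am r w else 0.

Let curL j : linear (cur j).
Proof. exact: current_linear HD _ _. Qed.

Let AmL n : linear (Am n).
Proof. by move=> d u v; rewrite /Am (linD (curL _)) (linZ (curL _)) scalerDr !scalerA mulrC. Qed.

Let ApL n : linear (Ap n).
Proof. by move=> d u v; rewrite /Ap (linD (curL _)) (linZ (curL _)) scalerDr !scalerA mulrC. Qed.

Lemma current_commute (i j : int) w : i + j != 0 -> cur i (cur j w) = cur j (cur i w).
Proof.
move=> ij; apply/eqP; rewrite -subr_eq0 (current_commutator HD).
by rewrite (negPf ij).
Qed.

Let AmC n m w : (0 < n)%N -> (0 < m)%N -> Am n (Am m w) = Am m (Am n w).
Proof.
move=> n0 m0; rewrite /Am !(linZ (curL _)) current_commute ?scalerA 1?mulrC //; lia.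
Qed.

Let ApC n m w : (0 < n)%N -> (0 < m)%N -> Ap n (Ap m w) = Ap m (Ap n w).
Proof.
move=> n0 m0; rewrite /Ap !(linZ (curL _)) current_commute ?scalerA 1?mulrC //; lia.
Qed.

(* The coefficients of the equation d/dz Y(x, z) y = Y(L(-1) x, z) y, where
   L(-1) x = q a h_(-1) x. *)
Lemma mode_primary_rec (r : nat) :
  r%:R *: mode x (- r%:Z - t - 1) y =
  \sum_(1 <= n < r.+1) n%:R *: Am n (mode x (- (r - n)%N%:Z - t - 1) y).
Proof.
have := voa_derivative HV x y (- r%:Z - t).
rewrite (primary_vir_m1 HD px) (modeZl HV).
rewrite (@associator _ _ _ HV h x y 0 (- r%:Z - t) r.+1); last first.
- by move=> i i0; apply: py.1; lia.
- by move=> i ri; apply: (primary_mode_eq0 HD (n := - t - 1) px py);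
    [rewrite ab; congr _%:~R|]; lia.
set S := \sum_(i < _) _ => e.
have -> : r%:R *: mode x (- r%:Z - t - 1) y = (q * a) *: S - t%:~R *: mode x (- r%:Z - t - 1) y.
  by rewrite e -scalerBl rmorphB rmorphN /=; congr (_ *: _); rewrite -pmulrn; ring.
rewrite {e}/S.
under eq_bigr => i _ do rewrite bin0 expr0 !scale1r.
(* In the second half only h_0 contributes, by b; multiplied by q a this is t, which cancels the t
   of the derivative. *)
rewrite big_split /= [X in _ *: (_ + X)](_ : _ = b *: mode x (- r%:Z - t - 1) y); last first.
  rewrite big_ord_recl /= big1 ?addr0 => [|i _]; last by rewrite py.1 ?(mode0r HV).
  by rewrite py.2 (modeZr HV); congr (_ *: mode _ _ _); lia.
rewrite big_ord_recr /=.
rewrite (primary_mode_eq0 HD (n := - t - 1) (n' := - r%:Z - t + r%:Z) px py) ?(mode0r HV).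
- rewrite addr0 scalerDr scalerA ab addrK scaler_sumr big_add1 big_mkord.
  apply: eq_bigr => i _; rewrite /Am (currentE HD) !scalerA mulrCA mulrA.
  rewrite mulfK ?pnatr_eq0 // [a * q]mulrC; congr (_ *: mode _ _ (mode _ _ _)).
    by move: (i : nat) => k; lia.
  by move: (ltn_ord i); move: (i : nat) => k; lia.
- by rewrite ab; congr _%:~R; lia.
- by lia.
Qed.

Lemma mode_primary (n : int) : mode x n y = em (- n - 1 - t) z.
Proof.
have [nt|nt] := ltP (- t - 1) n.
  rewrite (primary_mode_eq0 HD (n := - t - 1) px py) //; last by rewrite ab; congr _%:~R; lia.
  by rewrite /em; case E : (- n - 1 - t) => [r|//]; lia.
have [r hr] : exists r : nat, n = - r%:Z - t - 1 by exists (absz (- n - 1 - t)%R); lia.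
have -> : - n - 1 - t = r by lia.
rewrite hr /em (exp_coef_unique AmL AmC mode_primary_rec) /z.
by congr (exp_coef _ _ (mode _ _ _)); lia.
Qed.

Let emL j : linear (em j).
Proof.
by case: j => [r|r] d u v /=; [exact: exp_coef_linear AmL _ _ _ _|rewrite scaler0 addr0].
Qed.

Let em_cur j (i : nat) w : em j (cur (- i%:Z - 1) w) = cur (- i%:Z - 1) (em j w).
Proof.
case: j => [r|r] /=; last by rewrite (lin0 (curL _)).
rewrite (@exp_coef_commutator _ _ Am AmL AmC _ r.+1 0 w (curL _)) //.
  by rewrite ltnn addr0.
move=> n {}w n0; rewrite scale0r if_same addr0 /Am (linZ (curL _)) current_commute //; lia.
Qed.

Let ep_cur r (i : nat) w : exp_coef Ap r (cur (- i%:Z - 1) w) =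
  cur (- i%:Z - 1) (exp_coef Ap r w) +
  (if (i < r)%N then (- (a * q ^+ 2)) *: exp_coef Ap (r - i.+1) w else 0).
Proof.
apply: (@exp_coef_commutator _ _ Ap ApL ApC _ i.+1) => // n {}w n0.
rewrite /Ap (linZ (curL _)).
have := current_commutator HD q n (- i%:Z - 1) w; move/eqP; rewrite subr_eq => /eqP ->.
rewrite scalerDr addrC; congr (_ + _).
have -> : (n%:Z + (- i%:Z - 1) == 0) = (n == i.+1) by lia.
case: eqP => [->|_]; last by rewrite scaler0.
rewrite scalerA; congr (_ *: _); rewrite mulNr -mulrA; congr (- (_ * _)).
by rewrite mulrCA mulVf ?mulr1 // pnatr_eq0.
Qed.

Lemma ep_primary r : (0 < r)%N -> exp_coef Ap r z = 0.
Proof.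
have pz : primary h (q * a + b) z by apply: (primary_mode HD px py); rewrite ab; congr _%:~R; lia.
elim/ltn_ind: r => r IHr r0; apply: (@scalerI _ _ r%:R); first by rewrite pnatr_eq0 -lt0n.
rewrite scaler0 exp_coef_rec // big_nat big1 // => n /andP[n0 nr].
have [nr'|rn] := ltnP n r; first by rewrite IHr ?(lin0 (ApL n)) ?scaler0 //; lia.
have -> : (r - n)%N = 0%N by lia.
by rewrite exp_coef0 /Ap (currentE HD) pz.1 // !scaler0.
Qed.

(** Induction on the creation operators. Passing one through the annihilating exponential gives the
    same correction, - a q^2 times a shift by i + 1, as passing it through the modes of x. *)
Lemma vertex_operator_fock s : exists M,
  (forall r, (M <= r)%N -> exp_coef Ap r (fock_vector h q z s) = 0) /\
  forall n, mode x n (fock_vector h q y s) =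
    \sum_(r < M) em (r%:Z - n - 1 - t) (exp_coef Ap r (fock_vector h q z s)).
Proof.
elim/mset_ind: s => [|i s [M [hM IHs]]].
  exists 1%N; split=> [r r0|n]; first by rewrite fock_vector0 ep_primary.
  by rewrite !fock_vector0 big_ord1 exp_coef0 mode_primary add0r.
exists (M + i.+1)%N; rewrite !(fock_vector1D HD); split=> [r Mr|n].
  rewrite ep_cur !hM; [|lia|lia].
  by rewrite (lin0 (curL _)) add0r scaler0 if_same.
under eq_bigr => r _ do rewrite ep_cur (linD (emL _)) em_cur.
rewrite big_split /= -(lin_sum (curL _)).
rewrite (@big_ord_widen0 _ (fun r => em (r%:Z - n - 1 - t)
  (exp_coef Ap r (fock_vector h q z s))) M) ?leq_addr //; last first.
  by move=> r Mr; rewrite hM // (lin0 (emL _)).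
(* The corrections start at r = i + 1; reindexed from there, they are the induction hypothesis at
   the mode n - i - 1. *)
rewrite -IHs addnC big_split_ord /= [X in _ + (X + _)]big1 ?add0r => [|r _]; last first.
  by rewrite ltnNge -ltnS ltn_ord /= (lin0 (emL _)).
have -> : \sum_(r < M) em ((i.+1 + r)%N%:Z - n - 1 - t)
    (if (i < i.+1 + r)%N then - (a * q ^+ 2) *:
       exp_coef Ap (i.+1 + r - i.+1) (fock_vector h q z s) else 0) =
    - (a * q ^+ 2) *: mode x (- i%:Z - 1 + n) (fock_vector h q y s).
  rewrite IHs scaler_sumr; apply: eq_bigr => r _.
  rewrite leq_addr addKn (linZ (emL _)); congr (_ *: em _ _); lia.
rewrite !(currentE HD) (heis_primary HD _ n _ px) (modeZr HV) scalerDr !scalerA.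
by rewrite -addrA -scalerDl (_ : q * (q * a) + _ = 0) ?scale0r ?addr0 //; ring.
Qed.

End VertexOperator.

(** * The lattice of charges *)

Section Charges.
Variables (C : numClosedFieldType) (V : vertexData C) (phi : V -> V) (form : V -> V -> C).
Variable h : V.
Hypothesis HD : unitary_heisenberg phi form h.
Implicit Types (a b : C) (u v w x y z : V) (i j k : int).

Let HV := uh_voa HD.
Let Hphi := uh_phi HD.

Definition charge a := exists2 x, primary h a x & x != 0.

Lemma charge0 : charge 0.
Proof. by exists vac; [exact: primary_vac HD|exact: (vac_neq0 HV (uh_simple HD))]. Qed.

Lemma chargeD a b : charge a -> charge b -> charge (a + b).
Proof.
move=> [x px x0] [y py y0]; have [n [_ xy0 pxy _]] := primary_top HD px py x0 y0.
by exists (mode x n y).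
Qed.

Lemma chargeN a : charge a -> charge (- a).
Proof.
move=> [x px x0]; exists (phi x); first exact: (primary_phi HD).
have [_ phi_bij _ _ _] := Hphi.
by rewrite -(phi0 Hphi) (inj_eq (bij_inj phi_bij)).
Qed.

Lemma chargeM i a : charge a -> charge (i%:~R * a).
Proof.
move=> ca; elim/int_rec: i => [|n IHn|n IHn]; first by rewrite mul0r; apply: charge0.
  by rewrite -pmulrn -natr1 mulrDl mul1r pmulrn; apply: chargeD.
by rewrite mulrNz -pmulrn -natr1 opprD mulrDl mulN1r pmulrn -mulrNz; apply/chargeD/chargeN.
Qed.

Lemma charge_norm a : charge a -> exists p : nat, a ^+ 2 = (2 * p)%:R.
Proof. by move=> [x px x0]; have [p [ap _]] := primary_weight HD px x0; exists p. Qed.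

Lemma charge_product a b : charge a -> charge b -> exists t : int, a * b = t%:~R.
Proof.
move=> [x px x0] [y py y0]; have [n [abn _ _ _]] := primary_top HD px py x0 y0.
by exists (- n - 1).
Qed.

(** Euclidean division: [lam] has the least positive norm 2 N, and any b is reduced by a multiple of
    [lam] so that its product with [lam] lies in [0, 2 N). *)
Lemma charge_cyclic : (exists2 a, charge a & a != 0) ->
  exists (lam : C) (N : nat), [/\ charge lam, (0 < N)%N, lam ^+ 2 = (2 * N)%:R &
    forall b, charge b -> exists i : int, b = i%:~R * lam].
Proof.
move=> [a ca a0].
pose P (N : nat) := (0 < N)%N && `[< exists2 b, charge b & b ^+ 2 = (2 * N)%:R >].
have [p ap] := charge_norm ca.
have Pp : P p.
  apply/andP; split; last by apply/asboolP; exists a.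
  by rewrite lt0n; apply: contraNneq a0 => p0; rewrite p0 muln0 in ap; rewrite -sqrf_eq0 ap.
have [N /andP[N0 /asboolP[lam cl lamN]] Nmin] := ex_minnP (ex_intro P p Pp).
exists lam, N; split=> // b cb; have [t lbt] := charge_product cl cb.
exists (t %/ (2 * N)%N)%Z; set m := (t %/ _)%Z.
have cb' : charge (b - m%:~R * lam) by apply/chargeD/chargeN/chargeM.
have [M bM] := charge_norm cb'.
have lb' : lam * (b - m%:~R * lam) = (t %% (2 * N)%N)%Z%:~R.
  rewrite mulrBr lbt mulrCA -expr2 lamN [(2 * N)%:R]pmulrn -rmorphM -rmorphB /=.
  by rewrite {1}(divz_eq t (2 * N)%N) addrAC subrr add0r.
have e : ((t %% (2 * N)%N)%Z ^+ 2)%:~R = ((2 * N) * (2 * M))%:Z%:~R :> C.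
  by rewrite rmorphXn /= -lb' exprMn lamN bM -natrM pmulrn.
have {}e : (t %% (2 * N)%N)%Z ^+ 2 = ((2 * N) * (2 * M))%:Z by apply: intr_inj e.
have N20 : (2 * N)%N%:Z != 0 by lia.
have r0 := modz_ge0 t N20; have rN : (t %% (2 * N)%N)%Z < (2 * N)%N by apply: ltz_pmod; lia.
(* The remainder has square (2 N) (2 M). Were M > 0, minimality would give N <= M and the remainder
   would be at least 2 N. *)
have M0 : M = 0%N.
  apply/eqP; rewrite -leqn0 leqNgt; apply/negP => M0.
  have NM : (N <= M)%N.
    by apply: Nmin; rewrite /P M0; apply/asboolP; exists (b - m%:~R * lam).
  by move: e r0 rN; set r := (t %% _)%Z; nia.
by apply/eqP; rewrite -subr_eq0 -sqrf_eq0 bM M0 muln0.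
Qed.

Section Generator.
Variables (lam : C) (N : nat).
Hypotheses (N0 : (0 < N)%N) (lamN : lam ^+ 2 = (2 * N)%:R).

Let prim i := primary h (i%:~R * lam).
(** The leading coefficient of Y(u, z) v, at z^(2 N i j); the indices are explicit because the mode
    depends on the charges. *)
Let star i j u v := mode u (- ((2 * N)%:Z * i * j) - 1) v.

Lemma lam_product i j : i%:~R * lam * (j%:~R * lam) = ((2 * N)%:Z * i * j)%:~R.
Proof. by rewrite mulrACA -expr2 lamN [(2 * N)%:R]pmulrn mulrC -!rmorphM /= mulrA. Qed.

Let starP i j u v : prim i u -> prim j v -> prim (i + j) (star i j u v).
Proof.
move=> pu pv; rewrite /prim rmorphD mulrDl; apply: (primary_mode HD pu pv).
by rewrite lam_product; congr _%:~R; lia.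
Qed.

Let starA i j k u v w : prim i u -> prim j v -> prim k w ->
  star (i + j) k (star i j u v) w = star i (j + k) u (star j k v w).
Proof.
move=> pu pv pw.
have := @primary_associative _ _ _ _ _ HD _ _ _ u v w (- ((2 * N)%:Z * i * j) - 1)
   (- ((2 * N)%:Z * i * k)) (- ((2 * N)%:Z * j * k) - 1) pu pv pw.
rewrite !lam_product => A; rewrite /star; have {A} := A _ _ _.
have -> : - ((2 * N)%:Z * i * k) + (- ((2 * N)%:Z * j * k) - 1) =
  - ((2 * N)%:Z * (i + j) * k) - 1 by ring.
have -> : - ((2 * N)%:Z * i * j) - 1 - (2 * N)%:Z * i * k =
  - ((2 * N)%:Z * i * (j + k)) - 1 by ring.
by apply; congr _%:~R; ring.
Qed.

Let star1 i u v : star 0 i vac v = v.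
Proof. by rewrite /star mulr0 mul0r oppr0 sub0r (va_vacuum HV) eqxx. Qed.

Let star2 i u : star i 0 u vac = u.
Proof. by rewrite /star mulr0 oppr0 sub0r (va_creation HV u).1. Qed.

Let prim0 u : prim 0 u -> exists d, u = d *: vac.
Proof. by rewrite /prim mul0r; apply: (primary_vacuum HD). Qed.

Let prim_vac : prim 0 vac.
Proof. by rewrite /prim mul0r; apply: (primary_vac HD). Qed.

(** A nonzero vector of charge - lam multiplies x to a nonzero vector of charge 0, that is, a
    multiple of the vacuum; rescaling gives a right inverse, and associativity makes it
    two-sided. *)
Lemma invertible_generator x : prim 1 x -> x != 0 ->
  exists y, [/\ prim (-1) y, star 1 (-1) x y = vac & star (-1) 1 y x = vac].
Proof.
move=> px x0; have [y0 py0 y00] : charge (- 1%:~R * lam).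
  by rewrite mulNr; apply: chargeN; exists x.
have {}py0 : prim (-1) y0 by rewrite /prim rmorphN.
have [d hd] := prim0 (starP px py0).
have d0 : d != 0.
  have : star 1 (-1) x y0 != 0.
    by apply: (primary_mode_neq0 HD px py0 x0 y00); rewrite lam_product; congr _%:~R; lia.
  by apply: contraNneq => d0; rewrite hd d0 scale0r.
pose y := d^-1 *: y0; have py : prim (-1) y by apply: (primaryZ HD).
have xy : star 1 (-1) x y = vac.
  by rewrite /star (modeZr HV) -/(star _ _ _ _) hd scalerA mulVf // scale1r.
exists y; split=> //; have [d' hd'] := prim0 (starP py px).
have := starA py px py; rewrite xy star2 hd' /star (modeZl HV) -/(star _ _ _ _) star1 //.
move/eqP; rewrite -subr_eq0 -{2}[y]scale1r -scalerBl scaler_eq0 subr_eq0 => /orP[/eqP ->|].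
  by rewrite scale1r.
by rewrite scaler_eq0 invr_eq0 (negPf d0) (negPf y00).
Qed.

Lemma lattice_vectors : charge lam -> exists E : int -> V,
  [/\ E 0 = vac, forall i, primary h (i%:~R * lam) (E i), forall i, E i != 0,
      forall i j, mode (E i) (- ((2 * N)%:Z * i * j) - 1) (E j) = E (i + j) &
      forall i u, primary h (i%:~R * lam) u -> exists d, u = d *: E i].
Proof.
move=> [x]; rewrite -[lam in primary _ lam](mul1r lam) -[1]/(1%:~R) => px x0.
have [y [py xy yx]] := invertible_generator px x0.
(* Nonnegative powers are built from x and negative ones from its inverse y; associativity then
   gives the exponent law. *)
pose Ep := fix Ep n := if n is m.+1 then star 1 m%:Z x (Ep m) else vac.
pose En := fix En n := if n is m.+1 then star (-1) (- m%:Z) y (En m) else vac.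
pose E i := match i with Posz n => Ep n | Negz n => En n.+1 end.
have EN (n : nat) : E (- n%:Z) = En n by case: n.
have Eprim i : prim i (E i).
  elim/int_rec: i => [|n IHn|n IHn]; first exact: prim_vac.
    by rewrite -[n.+1]add1n PoszD; apply: starP.
  by have := starP py IHn; rewrite EN [E _]EN (_ : -1 + - n%:Z = - n.+1%:Z) //; lia.
have Ex i : star 1 i x (E i) = E (1 + i).
  case: i => // n; rewrite NegzE [E (- _)]EN [En n.+1]/=.
  have -> : - n.+1%:Z = -1 + - n%:Z by lia.
  by rewrite -EN -starA // addNKr xy star1.
have Ey i : star (-1) i y (E i) = E (-1 + i).
  case: i => [[|n]|n].
  - by rewrite (_ : -1 + 0 = - 1%:Z) // EN.
  - have -> : -1 + n.+1%:Z = n by lia.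
    rewrite [E n.+1]/= -[n.+1]add1n PoszD -starA //.
    by rewrite yx star1.
  - by rewrite NegzE EN (_ : -1 - n.+1%:Z = - n.+2%:Z) ?EN //; lia.
have EE i j : star i j (E i) (E j) = E (i + j).
  elim/int_rec: i => [|n IHn|n IHn]; first by rewrite star1 // add0r.
    by rewrite -[n.+1]add1n PoszD -Ex starA // IHn Ex addrA.
  rewrite -[n.+1]add1n PoszD opprD -Ey starA ?IHn ?Ey ?addrA //; exact: Eprim.
exists E; split=> // [i|i u pu].
  apply: contraTneq (vac_neq0 HV (uh_simple HD)) => Ei; rewrite negbK.
  by have := EE i (- i); rewrite subrr Ei /star (mode0l HV) => /esym/eqP.
(* Multiplying u by the inverse of E_i gives charge 0, hence d 1; multiplying back by E_i gives u =
   d E_i. *)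
have [d hd] : exists d, star (- i) i (E (- i)) u = d *: vac.
  by apply: prim0; have := starP (Eprim (- i)) pu; rewrite addNr.
exists d; have := starA (Eprim i) (Eprim (- i)) pu.
by rewrite EE subrr addNr star1 // hd /star (modeZr HV) -/(star _ _ _ _) star2.
Qed.

End Generator.
End Charges.

(** * Comparison with the models *)

Section Realization.
Variables (C : numClosedFieldType) (V : vertexData C) (phi : V -> V) (form : V -> V -> C).
Variable h : V.
Hypothesis HD : unitary_heisenberg phi form h.
Variables (k q : C).
Hypotheses (q0 : q != 0) (qk : q ^+ 2 = k).

Let HV := uh_voa HD.

Lemma heis_mode_linear n : n != 0 -> linear (@heis_mode C k n).
Proof. by case: n => [[//|n]|n] _; apply: lext_linear. Qed.

Lemma tens_linear a : linear (fun w => @tens C w a).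
Proof. exact: lext_linear. Qed.

Definition fock_module (x : V) : fock C -> V := lext (fock_vector h q x).

Lemma fock_module_linear x : linear (fock_module x).
Proof. exact: lext_linear. Qed.

(** The mode 0 is excluded: [heis_mode] is zero there, whereas h_0 acts by the charge a. *)
Lemma fock_module_heis a x n w : primary h a x -> n != 0 ->
  fock_module x (heis_mode k n w) = current h q n (fock_module x w).
Proof.
move=> px n0; move: w; apply: eq_linear.
- move=> d u v; rewrite (linD (heis_mode_linear n0)) (linZ (heis_mode_linear n0)).
  exact: fock_module_linear.
- move=> d u v; rewrite (linD (fock_module_linear x)) (linZ (fock_module_linear x)).
  exact: (current_linear HD).
- move=> s; rewrite [fock_module x << s >>]lext_basis.
  case: n n0 => [[//|n]|n] _; rewrite /= lext_basis.
    rewrite (linZ (fock_module_linear x)) [fock_module _ _]lext_basis.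
    by rewrite (currentS_fock HD q s n px) qk.
  rewrite [fock_module _ _]lext_basis (fock_vector1D HD); congr (current _ _ _ _).
  by rewrite NegzE; lia.
Qed.

Lemma fock_conf : (2%:R * k)^-1 *: fock_vector h q vac [mset 0; 0]%mset = conf.
Proof.
have -> : [mset 0; 0]%mset = (0%N +` (0%N +` mset0))%mset by rewrite msetD0.
rewrite !(fock_vector1D HD) fock_vector0.
rewrite !(currentE HD) (modeZr HV) (va_creation HV h).1 !scalerA (conf_heis HD).
congr (_ *: _); rewrite -qk; field; rewrite ?q0 //.
Qed.

Lemma heisenberg_iso : (forall a x, primary h a x -> x != 0 -> a = 0) ->
  VOA_iso V (heisenberg k).
Proof.
move=> no_charge.
pose p (s : {mset nat}%mset) := (s, tt); pose E (_ : unit) : V := vac.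
have Eprim i : primary h ((fun _ : unit => 0) i) (E i) by exact: (primary_vac HD).
have E0 i : E i != 0 by exact: (vac_neq0 HV (uh_simple HD)).
have ch_inj : injective (fun _ : unit => 0 : C) by case=> [] [].
have p_inj : injective p by move=> s s' [].
pose g : heisenberg k -> V := fock_map h q E p.
have gL : linear g by apply: fock_map_linear.
have gE s : g << s >> = fock_vector h q vac s by exact: fock_map_basis.
have g_inj : injective g by apply: (fock_map_inj HD q0 Eprim).
have g_heis m w : g (heis_mode k m w) = mode (q *: h) m (g w).
  (* The zero mode vanishes on both sides because the vacuum has charge 0. *)
  have [->|m0] := eqVneq m 0; last exact: (fock_module_heis w (primary_vac HD) m0).
  rewrite /= (lin0 gL); move: w; apply: (@eq_linear _ _ _ (fun=> 0)).
  - by move=> d u u'; rewrite /= scaler0 addr0.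
  - by move=> d u u'; rewrite (linD gL) (linZ gL); apply: (va_linr HV).
  move=> s; rewrite gE -[RHS]/(current h q 0 _) (current0_fock HD q s (primary_vac HD)).
  by rewrite mulr0 scale0r.
have g_vac m w : g (if m == -1 then w else 0) = mode vac m (g w).
  by rewrite (va_vacuum HV); case: ifP => // _; rewrite (lin0 gL).
apply: (VOA_iso_inverse gL g_inj).
- apply: (fock_map_surj HD q0) => [s []|a x px]; first by exists s.
  exists tt; have [->|x0] := eqVneq x 0; first by exists 0; rewrite scale0r.
  have a0 := no_charge _ _ px x0; rewrite a0 in px; exact: (primary_vacuum HD).
- by rewrite [LHS]gE fock_vector0.
- by rewrite [conf in LHS]/= (linZ gL) gE fock_conf.
- move=> u v n; rewrite [mode _ _ _ in LHS]/=; move: u; apply: eq_linear.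
  + move=> d u u'; rewrite (linD (lext_linear _)) (linZ (lext_linear _)); exact: gL.
  + move=> d u u'; rewrite (linD gL) (linZ gL) (modeDl HV) (modeZl HV) //.
  + by move=> s; rewrite lext_basis gE; exact: (mode_intertwine HV _ _ _ gL g_inj g_heis g_vac).
Qed.

End Realization.

(** The constraint determines r1 from r2, and f vanishes for r2 >= M, so the sum is one over r2 with
    the negative r1 left out. *)
Lemma fsum_exp_indices (W : zmodType) (f : nat -> nat -> W) (M : nat) (t n : int) :
  (forall r1 r2, (M <= r2)%N -> f r1 r2 = 0) ->
  \sum_(r \in [set r : nat * nat | r.1%:Z - r.2%:Z + t = - n - 1]) f r.1 r.2 =
  \sum_(r2 < M) if r2%:Z - n - 1 - t is Posz r1 then f r1 r2 else 0.
Proof.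
move=> f0; pose j (r2 : nat) := r2%:Z - n - 1 - t.
rewrite (@fsbigE _ _ _ _ _ [seq (absz (j r2), r2) | r2 <- iota 0 M & 0 <= j r2]).
- rewrite big_map big_filter_cond big_mkcond /= -[in LHS](subn0 M) big_mkord.
  apply: eq_bigr => r _; rewrite -/(j r).
  have -> : ((absz (j r), nat_of_ord r) \in
    [set r : nat * nat | r.1%:Z - r.2%:Z + t = - n - 1]%classic) = (0 <= j r).
    by apply/idP/idP; rewrite inE /= /j; lia.
  by rewrite andbb; case: (j r).
- by rewrite map_inj_uniq ?filter_uniq ?iota_uniq // => r r' [].
- move=> r /= /mapP[r2]; rewrite mem_filter => /andP[j0 _] -> /=; rewrite /j in j0 *; lia.
- move=> [r1 r2] /= e nin; apply: f0; rewrite leqNgt; apply: contra nin => r2M.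
  apply/mapP; exists r2; last by congr pair; rewrite /j; lia.
  by rewrite mem_filter mem_iota /= add0n r2M andbT /j; lia.
Qed.

Definition rank1_form (N : nat) (i j : int) : int := (2 * N)%:Z * i * j.

Lemma rank1_form_posdef (N : nat) : (0 < N)%N -> posdef_even_lattice (rank1_form N).
Proof.
move=> N0; rewrite /rank1_form; split=> [a b c|a b|a a0|a]; first by ring.
- by ring.
- by rewrite -mulrA; apply: mulr_gt0; [lia|rewrite -expr2 exprn_even_gt0].
- by rewrite PoszM -!mulrA dvdz_mulr.
Qed.

(** * The lattice model *)

Section LatticeRealization.
Variables (C : numClosedFieldType) (V : vertexData C) (phi : V -> V) (form : V -> V -> C).
Variable h : V.
Hypothesis HD : unitary_heisenberg phi form h.
Variables (lam : C) (N : nat) (E : int -> V).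
Hypotheses (N0 : (0 < N)%N) (lamN : lam ^+ 2 = (2 * N)%:R).
Hypotheses (E_0 : E 0 = vac) (Eprim : forall i, primary h (i%:~R * lam) (E i)).
Hypotheses (E_neq0 : forall i, E i != 0).
Hypothesis EE : forall i j, mode (E i) (- ((2 * N)%:Z * i * j) - 1) (E j) = E (i + j).
Hypothesis Espan : forall i u, primary h (i%:~R * lam) u -> exists d, u = d *: E i.
Hypothesis charges : forall b, charge h b -> exists i : int, b = i%:~R * lam.

Let HV := uh_voa HD.
Let B := rank1_form N.
Let k : C := (B 1 1)%:~R.

Let lam0 : lam != 0.
Proof. by rewrite -sqrf_eq0 lamN pnatr_eq0 muln_eq0 -lt0n N0. Qed.

Let lamk : lam ^+ 2 = k.
Proof. by rewrite lamN /k /B /rank1_form !mulr1. Qed.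

Let K := ({mset nat}%mset * int)%type.
Let g : latticeVOA C B -> V := fock_map h lam E (fun b : K => b).

Let gL : linear g. Proof. exact: fock_map_linear. Qed.

Let gE (b : K) : g << b >> = fock_vector h lam (E b.2) b.1.
Proof. exact: fock_map_basis. Qed.

Let g_inj : injective g.
Proof.
apply: (fock_map_inj HD lam0 Eprim) => [//|i j /(mulIf lam0)|//].
exact: intr_inj.
Qed.

Let g_tens a w : g (tens w a) = fock_module h lam (E a) w.
Proof.
move: w; apply: eq_linear => [d u v|d u v|s].
- by rewrite (linD (tens_linear a)) (linZ (tens_linear a)); apply: gL.
- exact: fock_module_linear.
- by rewrite /tens lext_basis gE [RHS]lext_basis.
Qed.

Lemma lattice_mode_realized n w : g (lattice_mode B n w) = current h lam n (g w).
Proof.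
have modeL : linear (@lattice_mode C B n) := lext_linear _.
move: w; apply: eq_linear => [d u v|d u v|b].
- by rewrite (linD modeL) (linZ modeL); apply: gL.
- by rewrite (linD gL) (linZ gL); apply: (current_linear HD).
rewrite /lattice_mode lext_basis gE; case: eqP => [->|/eqP n0].
  rewrite (linZ gL) gE (current0_fock HD lam _ (Eprim _)); congr (_ *: _).
  by rewrite mulrCA -expr2 lamN mulrC [(2 * N)%:R]pmulrn -rmorphM /B /rank1_form mulr1.
by rewrite g_tens (fock_module_heis HD lam0 lamk _ (Eprim _) n0) [fock_module _ _ _ _]lext_basis.
Qed.

Lemma exp_mode_realized a n w : g (exp_mode B a n w) = mode (E a) n (g w).
Proof.
have modeL : linear (@exp_mode C B a n) := lext_linear _.
move: w; apply: eq_linear => [d u v|d u v|[s b]].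
- by rewrite (linD modeL) (linZ modeL); apply: gL.
- by rewrite (linD gL) (linZ gL); apply: (va_linr HV).
rewrite /exp_mode lext_basis gE (lin_fsum gL) //=.
have pa : primary h (lam * a%:~R) (E a) by rewrite mulrC.
have ab : lam * a%:~R * (b%:~R * lam) = (B a b)%:~R.
  by rewrite [lam * _]mulrC (lam_product lamN).
have [M [hM ->]] := vertex_operator_fock HD pa (Eprim b) ab s.
(* The leading coefficient of Y(E_a, z) E_b is exactly E_(a + b), which matches the cocycle-free
   operators of the model. *)
rewrite [B a b]/(rank1_form N a b) /rank1_form EE in hM *.
pose f r1 r2 := exp_coef (fun (n : nat) x => (a%:~R / n%:R) *: current h lam (- n%:Z) x) r1
  (exp_coef (fun (n : nat) x => - (a%:~R / n%:R) *: current h lam n%:Z x) r2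
     (fock_vector h lam (E (a + b)) s)).
rewrite -(@fsum_exp_indices _ f) => [|r1 r2 r2M]; last first.
  rewrite /f hM //; apply: lin0; apply: exp_coef_linear => m d u v.
  by rewrite (current_linear HD) scalerDr !scalerA mulrC.
apply: eq_fsbigr => -[r1 r2] _ /=; rewrite g_tens /exp_minus /exp_plus /f.
have fmL := fock_module_linear h lam (E (a + b)).
rewrite (@exp_coef_intertwine _ _ _ _ _
  (fun (n : nat) x => (a%:~R / n%:R) *: current h lam (- n%:Z) x) fmL).
  rewrite (@exp_coef_intertwine _ _ _ _ _
    (fun (n : nat) x => - (a%:~R / n%:R) *: current h lam n%:Z x) fmL).
    by rewrite [fock_module _ _ _ _]lext_basis.
  move=> m w m0; rewrite (linZ fmL) (fock_module_heis HD lam0 lamk _ (Eprim _)) //; lia.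
move=> m w m0; rewrite (linZ fmL) (fock_module_heis HD lam0 lamk _ (Eprim _)) //; lia.
Qed.

Lemma lattice_iso : VOA_iso V (latticeVOA C B).
Proof.
apply: (VOA_iso_inverse gL g_inj).
- apply: (fock_map_surj HD lam0) => [s i|a x px]; first by exists (s, i).
  have [->|x0] := eqVneq x 0; first by exists 0, 0; rewrite scale0r.
  have [i ai] : exists i : int, a = i%:~R * lam by apply: charges; exists x.
  by exists i; apply: Espan; rewrite -ai.
- by rewrite [LHS]g_tens [LHS]lext_basis fock_vector0.
- rewrite [LHS]g_tens (linZ (fock_module_linear _ _ _)) [fock_module _ _ _ _]lext_basis E_0.
  exact: (fock_conf HD lam0 lamk).
- move=> u v n; rewrite [mode _ _ _ in LHS]/=; move: u; apply: eq_linear.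
  + move=> d u u'; rewrite (linD (lext_linear _)) (linZ (lext_linear _)); exact: gL.
  + by move=> d u u'; rewrite (linD gL) (linZ gL) (modeDl HV) (modeZl HV).
  + move=> b; rewrite lext_basis gE.
    exact: (mode_intertwine HV _ _ _ gL g_inj lattice_mode_realized (exp_mode_realized b.2)).
Qed.

End LatticeRealization.

(* h = C alpha carries the non-degenerate form with (alpha, alpha) = k. *)
Theorem proposition5p2 (R : realType) (V : vertexData R[i]) (phi : V -> V)
    (alpha : V) (k : R[i]) :
  is_VOA V 1 -> simple_VOA V -> CFT_type V -> unitary phi ->
  alpha != 0 -> abelian_subalgebra (line alpha) ->
  (exists r : R, phi alpha = (r%:C)%C *: alpha) ->
  k != 0 ->
  VOA_iso V (heisenberg k) \/
  exists B : int -> int -> int,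
    posdef_even_lattice B /\ VOA_iso V (latticeVOA R[i] B).
Proof.
move=> HV HS HC [[Hphi phiK _] [form [Hform Hinv]]] alpha0 [_ h1 h0] [r hr] k0.
have la : line alpha alpha by exists 1; rewrite scale1r.
have rC : ((r%:C)%C : R[i])^* = (r%:C)%C by exact: conjc_real.
have [h [hw hh0 hh1 hphi]] :=
  normalized_heisenberg HV HC Hphi Hform Hinv HS phiK alpha0 (h1 _ la) (h0 _ _ la la) rC hr.
have HD : unitary_heisenberg phi form h :=
  UnitaryHeisenberg HV HS HC Hphi Hform Hinv hw hh0 hh1 hphi.
have [nz|no_charge] := pselect (exists2 a, charge h a & a != 0); last first.
  (* Any nonzero level k is reached by taking gamma = q h with q a square root of k. *)
  left; apply: (@heisenberg_iso _ _ _ _ _ HD k (sqrtC k));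
    rewrite ?sqrtC_eq0 ?sqrtCK // => a x px x0.
  by apply/eqP; apply: contraT => a0; case: no_charge; exists a => //; exists x.
right; have [lam [N [cl N0 lamN charges]]] := charge_cyclic HD nz.
have [E [E_0 Eprim E_neq0 EE Espan]] := lattice_vectors HD N0 lamN cl.
exists (rank1_form N); split; first exact: (rank1_form_posdef N0).
exact: (lattice_iso HD N0 lamN E_0 Eprim E_neq0 EE Espan charges).
Qed.
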